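(* Let $D$ be a domain in $\mathbb R^n$, $n\ge2$, and let $\Phi:[1,\infty]\to[0,\infty]$ be a nonconstant function with $\Phi(\infty)=\infty$. If $\Phi$ is either not convex, or not nondecreasing, or not continuous from the left at the point $T=\sup\{t:\Phi(t)<\infty\}$, then there exists a sequence of homeomorphisms $f_j$ of $D$ into $\mathbb R^n$ of class $W^{1,1}_{\rm loc}(D)$ converging locally uniformly to a mapping $f:D\to\mathbb R^n$ that is differentiable a.e., such that for every open bounded set $\Omega\subseteq D$ and every continuous function $\Psi:\mathbb R^n\to(0,\infty)$ $$\int_\Omega\Phi(P_f(x))\,\Psi(x)\,dm(x)>\limsup_{j\to\infty}\int_\Omega\Phi(P_{f_j}(x))\,\Psi(x)\,dm(x).$$ In particular this holds for $\Psi\equiv1$ and for $\Psi(x)=(1+|x|^2)^{-n}$.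
   Context: Continuity is in the topology of $[0,\infty]$. For $x\in D$ with all first partials, $\|f'(x)\|=\sup_{|h|=1}|f'(x)h|$, $J_f(x)=\det f'(x)$; the outer dilatation is $K_f(x)=\|f'(x)\|^n/|J_f(x)|$ if $J_f(x)\ne0$, $K_f(x)=1$ if $f'(x)=0$, and $K_f(x)=\infty$ otherwise (including points without first partial derivatives). $P_f(x)=K_f(x)^{1/(n-1)}$. *)

(* Defs.v *)
From HB Require Import structures.
From mathcomp Require Import all_boot all_order all_algebra.
From mathcomp Require Import all_classical all_reals all_analysis.
Set Implicit Arguments. Unset Strict Implicit. Unset Printing Implicit Defensive.
Import Order.TTheory GRing.Theory Num.Theory numFieldNormedType.Exports.
Local Open Scope classical_set_scope.
Local Open Scope ring_scope.

Section Rn.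
Variable R : realType.

Fixpoint Mn (n : nat) : {d : measure_display & measurableType d} :=
  match n with
  | 0 => existT (fun d => measurableType d) _ (unit : measurableType _)
  | m.+1 => existT (fun d => measurableType d) _
      ((projT2 (Mn m) * measurableTypeR R)%type : measurableType _)
  end.

Fixpoint lebn (n : nat) : {measure set (projT2 (Mn n)) -> \bar R} :=
  match n as n0 return {measure set (projT2 (Mn n0)) -> \bar R} with
  | 0 => [the {measure set unit -> \bar R} of @dirac _ unit tt R]
  | m.+1 => [the {measure set _ -> \bar R} of
              ((lebn m) \x (@lebesgue_measure R))%E]
  end.
End Rn.

Section Dilatation.
Variables (R : realType) (n : nat).
Local Notation V := 'rV[R]_n.

Fixpoint coord (m : nat) : projT2 (Mn R m) -> nat -> R :=
  match m as m0 return projT2 (Mn R m0) -> nat -> R with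
  | 0 => fun _ _ => 0
  | m'.+1 => fun p k => if k == m' then p.2 else coord p.1 k
  end.

Definition tup2rv (p : projT2 (Mn R n)) : V := \row_(i < n) coord p i.

(* Lebesgue integral over A of g : R^n -> [-oo,+oo] (n-dim Lebesgue measure
   is the image of the n-fold product of the 1-dim Lebesgue measure) *)
Definition intRn (A : set V) (g : V -> \bar R) : \bar R :=
  (\int[lebn R n]_(p in tup2rv @^-1` A) g (tup2rv p))%E.

Definition Rn_null (N : set V) : Prop := (lebn R n).-negligible (tup2rv @^-1` N).

Definition ebasis (j : 'I_n) : V := delta_mx 0 j.

Definition eucl (p q : nat) (M : 'M[R]_(p, q)) : R :=
  Num.sqrt (\sum_i \sum_j M i j ^+ 2).

Definition loc_integrable (D : set V) (u : V -> R) : Prop :=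
  forall K : set V, compact K -> K `<=` D ->
    (lebn R n).-integrable (tup2rv @^-1` K) (fun p => (u (tup2rv p))%:E).

Definition iterD (s : seq 'I_n) (phi : V -> R) : V -> R :=
  foldr (fun j g => 'D_(ebasis j) g) phi s.

Definition test_fun (D : set V) (phi : V -> R) : Prop :=
  (forall s, continuous (iterD s phi)) /\
  (forall s j x, derivable (iterD s phi) x (ebasis j)) /\
  compact (closure [set x | phi x != 0]) /\
  closure [set x | phi x != 0] `<=` D.

Definition W11loc (D : set V) (f : V -> V) : Prop :=
  forall i : 'I_n,
    loc_integrable D (fun x => f x 0 i) /\
    forall j : 'I_n, exists g : V -> R,
      loc_integrable D g /\
      forall phi, test_fun D phi ->
        intRn D (fun x => (f x 0 i * 'D_(ebasis j) phi x)%:E) =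
        (- intRn D (fun x => (g x * phi x)%:E))%E.

Definition homeo_into (D : set V) (f : V -> V) : Prop :=
  {within D, continuous f} /\
  (forall x y, D x -> D y -> f x = f y -> x = y) /\
  exists g : V -> V, (forall x, D x -> g (f x) = x) /\
    {within f @` D, continuous g}.

Definition loc_unif_cvg (D : set V) (fs : nat -> V -> V) (f : V -> V) : Prop :=
  forall K : set V, compact K -> K `<=` D ->
  forall eps : R, 0 < eps ->
    \forall j \near \oo, forall x, K x -> eucl (fs j x - f x) < eps.

Definition ae_differentiable (D : set V) (f : V -> V) : Prop :=
  Rn_null [set x | D x /\ ~ differentiable f x].

Definition has_partials (f : V -> V) (x : V) : Prop :=
  forall j : 'I_n, derivable f x (ebasis j).

Definition jac (f : V -> V) (x : V) : 'M[R]_n :=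
  \matrix_(i, j) ('D_(ebasis j) f x) 0 i.

Definition opnorm (A : 'M[R]_n) : R :=
  sup [set eucl (A *m h) | h in [set h : 'cV[R]_n | eucl h = 1]].

Definition Kf (f : V -> V) (x : V) : \bar R :=
  if `[< has_partials f x >] then
    (if \det (jac f x) != 0 then
       ((opnorm (jac f x) ^+ n / `|\det (jac f x)|)%:E)
     else if jac f x == 0 then 1%E else +oo%E)
  else +oo%E.

Definition Pf (f : V -> V) (x : V) : \bar R :=
  poweR (Kf f x) ((n - 1)%:R)^-1.

End Dilatation.

Section PhiConditions.
Variable R : realType.
Local Open Scope ereal_scope.

(* Phi : [1,+oo] -> [0,+oo], represented as a map \bar R -> \bar R whose
   values outside [1,+oo] are irrelevant *)
Definition Phi_convex (Phi : \bar R -> \bar R) : Prop :=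
  forall s t l : R, (1 <= s)%R -> (1 <= t)%R -> (0 < l < 1)%R ->
    Phi (l * s + (1 - l) * t)%:E <= l%:E * Phi s%:E + (1 - l)%:E * Phi t%:E.

Definition Phi_nondecreasing (Phi : \bar R -> \bar R) : Prop :=
  forall s t : \bar R, 1 <= s -> s <= t -> Phi s <= Phi t.

Definition Phi_T (Phi : \bar R -> \bar R) : \bar R :=
  ereal_sup [set t%:E | t in [set t : R | (1 <= t)%R /\ Phi t%:E < +oo]].

Definition Phi_leftcont_T (Phi : \bar R -> \bar R) : Prop :=
  match Phi_T Phi with
  | r%:E => r = 1%R \/ (Phi x%:E @[x --> r^'-] --> Phi r%:E)
  | +oo => Phi x%:E @[x --> +oo%R] --> Phi +oo
  | -oo => True
  end.

End PhiConditions.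

(* Main.v *)
Require Import Defs.
From HB Require Import structures.
From mathcomp Require Import all_boot all_order all_algebra.
From mathcomp Require Import all_classical all_reals all_analysis.
From mathcomp Require Import measurable_realfun.
From mathcomp Require Import ring lra.
Set Implicit Arguments.
Unset Strict Implicit.
Unset Printing Implicit Defensive.
Import Order.TTheory GRing.Theory Num.Theory numFieldNormedType.Exports.
Local Open Scope classical_set_scope.
Local Open Scope ring_scope.

(** Everything happens in one direction: all maps are stretches
    [x |-> (x_1, ..., x_(n-1), v x_n)] of the last coordinate.  Where [v' = a],
    the function [P] equals [a] if [a >= 1], equals [t] if [a = t^-(n-1)] with
    [t >= 1], and is infinite if [a = 0].  Hence [f_j] with [v_j] a zigzag
    taking the slopes [a] and [b] with frequencies [l] and [1 - l] on the scale
    [1/(j+1)] converge to the linear stretch by [l a + (1 - l) b], while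
    [Phi(P_(f_j))] converges weakly to [l Phi(P_a) + (1 - l) Phi(P_b)].
    - If [Phi] violates convexity at [s], [t], [l], take the slopes [s] and [t].
    - If [s < t] and [Phi s > Phi t], take the slopes [t] and [t^-(n-1)], both
      with [P = t], with average [s].
    - If [Phi] is nondecreasing but jumps at [T], take linear stretches: with
      slopes increasing to [T] when [T] is finite, and with slopes
      [x_j^-(n-1) -> 0] when [T] is infinite and [Phi] stays bounded along
      [x_j -> +oo]; in the latter case the limit is a projection, with [P]
      infinite everywhere. *)

(** * Iterated Lebesgue measure *)

(* The bare name would denote the coordinates of [vector]. *)
Local Notation coord := Defs.coord.
Section product_lebesgue.
Variable R : realType.

(** One sequence must serve every [Omega] and [Psi] at once. It is therefore arranged that
    [Phi(P_(f_j))] is bounded, off a null set, by densities that converge weakly to a constant [L]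
    against every integrable weight, while [P] is constant along the limit map. The claim then
    reduces to the scalar inequality [L < Phi(P)], multiplied by the integral of [Psi] over [Omega],
    which is positive and finite. Since only the last coordinate is stretched, Fubini turns any pair
    [Omega], [Psi] into one integrable weight of one variable.

    The two formulas for [P] come from [K = max(a, 1)^n / a] for a stretch with slope [a > 0], which
    is [a^(n-1)] when [a >= 1] and [1/a] when [a <= 1]. The contracting branch is what defeats a
    decreasing [Phi]: two slopes with the same [P = t] can have any mean between [t^-(n-1)] and [t],
    in particular [s < t].

    [Phi] is an arbitrary function, so [Phi(P_(f_j))] has no regularity of its own, and at kinks it
    may be infinite. Its integrals are only bounded from above, by measurable majorants valid off
    the kinks; for the limit map the integral is exact. *)

Definition lrect m (a b : nat -> R) : set (projT2 (Mn R m)) :=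
  [set p | forall k, (k < m)%N -> a k <= coord p k <= b k].

Lemma coordS m (p : projT2 (Mn R m.+1)) k :
  coord p k = if k == m then p.2 else coord p.1 k.
Proof. by []. Qed.

Lemma lrectS m a b : @lrect m.+1 a b = @lrect m a b `*` `[a m, b m]%classic.
Proof.
apply/seteqP; split=> -[q y] /= h.
- split; last by rewrite in_itv /=; have := h m (ltnSn m); rewrite coordS eqxx.
  move=> k km; have := h k (ltn_trans km (ltnSn m)).
  by rewrite coordS (ltn_eqF km).
- case: h => h1; rewrite in_itv /= => h2 k; rewrite ltnS leq_eqVlt coordS.
  case/orP => [/eqP ->|km]; first by rewrite eqxx.
  by rewrite (ltn_eqF km); exact: h1.
Qed.

Lemma lrect_measurable m a b : measurable (@lrect m a b).
Proof.
elim: m => [|m IH]; last by rewrite lrectS; exact: measurableX.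
by rewrite (_ : @lrect 0 a b = setT)//; apply/seteqP; split.
Qed.

Lemma lebn_lrect m a b : (forall k, a k < b k) ->
  (0 < lebn R m (@lrect m a b) < +oo)%E.
Proof.
move=> ab; elim: m => [|m /andP[IH0 IHoo]].
  rewrite (_ : @lrect 0 a b = setT); last by apply/seteqP; split.
  by rewrite /= diracE in_setT lte01 ltry.
have e : lebn R m.+1 (@lrect m a b `*` `[a m, b m]%classic) =
    (lebn R m (@lrect m a b) * lebesgue_measure `[a m, b m]%classic)%E.
  apply: (@product_measure1E _ _ _ _ _ (lebn R m) lebesgue_measure) => //.
  exact: lrect_measurable.
rewrite lrectS e lebesgue_measure_itv /= lte_fin ab.
have abp : (0 < (b m - a m)%:E)%E by rewrite lte_fin subr_gt0.
by rewrite -EFinB mule_gt0//= lte_mul_pinfty// ?ltW// ?ltry// ge0_fin_numE ?ltW.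
Qed.

Lemma coord_measurable m k :
  measurable_fun [set: projT2 (Mn R m)] (fun p => coord p k).
Proof.
elim: m => [|m IH]; first exact: measurable_cst.
have [->|km] := eqVneq k m.
- rewrite (_ : (fun p => _) = (fun p : projT2 (Mn R m) * R => p.2)).
    exact: (@measurable_snd _ _ (projT2 (Mn R m)) (measurableTypeR R)).
  by apply/funext => p; rewrite coordS eqxx.
- rewrite (_ : (fun p => _) =
    (fun q => coord q k) \o (fun p : projT2 (Mn R m) * R => p.1)).
    apply: measurableT_comp => //.
    exact: (@measurable_fst _ _ (projT2 (Mn R m)) (measurableTypeR R)).
  by apply/funext => p; rewrite coordS (negbTE km).
Qed.

Lemma lebn_sigma_finite m : sigma_finite setT (lebn R m).
Proof.
exists (fun i => @lrect m (fun=> - i.+1%:R) (fun=> i.+1%:R)); last first.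
  move=> i; split; first exact: lrect_measurable.
  by case/andP: (@lebn_lrect m (fun=> - i.+1%:R) (fun=> i.+1%:R)
    (fun=> gtrN (ltr0Sn R i))).
apply/esym/seteqP; split=> // p _.
pose M := \sum_(k < m) `|coord p k|.
exists (Num.bound M) => // k km; rewrite -ler_norml.
apply: (@le_trans _ _ M).
  by rewrite /M (bigD1 (Ordinal km))//= lerDl sumr_ge0.
apply: ltW; apply: (lt_le_trans (archi_boundP _)); first exact: sumr_ge0.
by rewrite ler_nat.
Qed.

(* [lebn] is a bundled measure; sigma-finiteness is attached to the underlying
   function, and the two measures are convertible. *)
Definition lebn_fun m : set (projT2 (Mn R m)) -> \bar R := lebn R m.

HB.instance Definition _ m := Measure.copy (@lebn_fun m) (lebn R m).
HB.instance Definition _ m :=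
  Measure_isSigmaFinite.Build _ _ _ (@lebn_fun m) (lebn_sigma_finite m).

Lemma lebn_fubini1 m (F : projT2 (Mn R m.+1) -> \bar R) :
  measurable_fun [set: projT2 (Mn R m.+1)] F -> (forall p, 0 <= F p)%E ->
  (\int[lebn R m.+1]_p F p =
   \int[lebn R m]_q \int[lebesgue_measure]_y F (q, y))%E.
Proof.
move=> mF F0.
exact: (@fubini_tonelli1 _ _ _ _ _ (@lebn_fun m) lebesgue_measure F).
Qed.

Lemma lebn_fubini2 m (F : projT2 (Mn R m.+1) -> \bar R) :
  measurable_fun [set: projT2 (Mn R m.+1)] F -> (forall p, 0 <= F p)%E ->
  (\int[lebn R m.+1]_p F p =
   \int[lebesgue_measure]_y \int[lebn R m]_q F (q, y))%E.
Proof.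
move=> mF F0.
exact: (@fubini_tonelli2 _ _ _ _ _ (@lebn_fun m) lebesgue_measure F).
Qed.

Lemma measurable_lebn_slice1 m (F : projT2 (Mn R m.+1) -> \bar R) :
  measurable_fun [set: projT2 (Mn R m.+1)] F -> (forall p, 0 <= F p)%E ->
  measurable_fun setT (fun q => \int[lebesgue_measure]_y F (q, y))%E.
Proof.
move=> mF F0.
exact: (@measurable_fun_fubini_tonelli_F _ _ _ _ _ lebesgue_measure F).
Qed.

Lemma measurable_lebn_slice2 m (F : projT2 (Mn R m.+1) -> \bar R) :
  measurable_fun [set: projT2 (Mn R m.+1)] F -> (forall p, 0 <= F p)%E ->
  measurable_fun setT (fun y : measurableTypeR R => \int[lebn R m]_q F (q, y))%E.
Proof.
move=> mF F0.
exact: (@measurable_fun_fubini_tonelli_G _ _ _ _ _ (@lebn_fun m) F).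
Qed.

(** The pushforward of Lebesgue measure under a translation agrees with it on half-open intervals,
    hence everywhere by uniqueness; the rest is change of variables. *)
Lemma lebesgue_translation (F : R -> \bar R) (s : R) :
  measurable_fun [set: measurableTypeR R] F -> (forall y, 0 <= F y)%E ->
  (\int[lebesgue_measure]_y F (y + s)%R = \int[lebesgue_measure]_y F y)%E.
Proof.
move=> mF F0.
pose phi : measurableTypeR R -> measurableTypeR R := fun y => y + s.
have mphi : measurable_fun setT phi by apply: measurable_funD.
pose nu := pushforward lebesgue_measure phi.
have e A : measurable A -> lebesgue_measure A = nu A.
  apply: lebesgue_measure_unique => _ [[a b]] _ <-.
  rewrite /nu /= /pushforward.
  rewrite (_ : phi @^-1` _ = `]a - s, b - s]%classic); last first.
    by apply/seteqP; split=> y /=; rewrite !in_itv /= /phi ltrBlDr lerBrDr.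
  by rewrite !lebesgue_measure_itv /= !lte_fin ltrD2r -!EFinB opprD addrACA subrr addr0.
rewrite -[RHS](_ : (\int[nu]_y F y = _)%E).
  by rewrite (ge0_integral_pushforward mphi).
by apply: eq_measure_integral => A mA _; exact: (esym (e _ mA)).
Qed.

(** The shift is indexed by [nat], like the bounds of [lrect], so that the same sequence serves in
    every dimension of a recursion; only its first [m] entries are read. *)
Fixpoint shiftn m (s : nat -> R) : projT2 (Mn R m) -> projT2 (Mn R m) :=
  match m as m0 return projT2 (Mn R m0) -> projT2 (Mn R m0) with
  | 0 => fun p => p
  | m'.+1 => fun p => (shiftn s p.1, p.2 + s m')
  end.

Lemma coord_shiftn m s (p : projT2 (Mn R m)) k : (k < m)%N ->
  coord (shiftn s p) k = coord p k + s k.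
Proof.
elim: m p => // m IH p; rewrite ltnS leq_eqVlt => /orP[/eqP ->|km].
  by rewrite !coordS eqxx.
by rewrite !coordS (ltn_eqF km) IH.
Qed.

Lemma shiftn_measurable m s : measurable_fun setT (@shiftn m s).
Proof.
elim: m => [|m IH]; first exact: measurable_id.
apply/measurable_fun_pairP; split => /=.
- have m1 : measurable_fun setT (fun p : projT2 (Mn R m) * measurableTypeR R => p.1).
    exact: measurable_fst.
  exact: (measurableT_comp IH m1).
- have m2 : measurable_fun setT (fun p : projT2 (Mn R m) * measurableTypeR R => p.2 : measurableTypeR R).
    exact: measurable_snd.
  exact: (measurable_funD m2 (measurable_cst (s m))).
Qed.

(** By Fubini, the one-dimensional case shifts the inner integral and the induction hypothesis,
    applied to the function of slices, shifts the outer one. *)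
Lemma lebn_translation m s (F : projT2 (Mn R m) -> \bar R) :
  measurable_fun [set: projT2 (Mn R m)] F -> (forall p, 0 <= F p)%E ->
  (\int[lebn R m]_p F (shiftn s p) = \int[lebn R m]_p F p)%E.
Proof.
elim: m F => [|m IH] F mF F0 //.
have mFs : measurable_fun setT (F \o @shiftn m.+1 s).
  by apply: measurableT_comp => //; exact: shiftn_measurable.
rewrite (lebn_fubini1 mFs)//= (lebn_fubini1 mF)//.
rewrite -[RHS]IH; last 2 first.
- exact: measurable_lebn_slice1.
- by move=> q; apply: integral_ge0.
apply: eq_integral => q _.
apply: (@lebesgue_translation (fun y => F (shiftn s q, y))) => //.
by apply: measurableT_comp => //; exact: measurable_pair1.
Qed.

End product_lebesgue.

(** * Measurability in R^n *)

Section euclidean_space.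
Variables (R : realType) (n : nat).
Local Notation V := 'rV[R]_n.

Lemma coord_le_norm (x : V) i : `|x 0 i| <= `|x|.
Proof.
rewrite [leRHS]mx_normrE.
by rewrite (bigmax_sup (0, i)).
Qed.

Lemma norm_le_coord (x : V) r : 0 <= r -> (forall i, `|x 0 i| <= r) -> `|x| <= r.
Proof.
move=> r0 xr; rewrite [leLHS]mx_normrE; apply/bigmax_leP; split=> // -[a i] _ /=.
by rewrite (ord1 a).
Qed.

Lemma norm_lt_coord (x : V) r : 0 < r -> (forall i, `|x 0 i| < r) -> `|x| < r.
Proof.
move=> r0 xr; rewrite [ltLHS]mx_normrE; apply/bigmax_ltP; split=> // -[a i] _ /=.
by rewrite (ord1 a).
Qed.

Lemma tup2rvE (p : projT2 (Mn R n)) i : tup2rv p 0 i = coord p i.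
Proof. by rewrite mxE. Qed.

Lemma tup2rv_shiftn (s : nat -> R) (p : projT2 (Mn R n)) :
  tup2rv (shiftn s p) = tup2rv p + \row_i s i.
Proof. by apply/rowP => i; rewrite !mxE coord_shiftn. Qed.

Lemma tup2rv_lrect a b : @lrect R n a b =
  (@tup2rv R n) @^-1` [set x : V | forall i : 'I_n, a i <= x 0 i <= b i].
Proof.
apply/seteqP; split=> p /= h.
- by move=> i; rewrite tup2rvE; exact: h.
- by move=> k kn; have := h (Ordinal kn); rewrite tup2rvE.
Qed.

(** This links the topology of row vectors to the product sigma-algebra: an open set is the union of
    the countably many closed boxes with rational centre and radius [1/(k+1)] that it contains. *)
Lemma open_preimage_measurable (A : set V) : open A ->
  measurable ((@tup2rv R n) @^-1` A : set (projT2 (Mn R n))).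
Proof.
move=> oA.
pose a (c : 'rV[rat]_n * nat) (k : nat) : R :=
  (if insub k is Some i then ratr (c.1 0 i) else 0) - c.2.+1%:R^-1.
pose b (c : 'rV[rat]_n * nat) (k : nat) : R :=
  (if insub k is Some i then ratr (c.1 0 i) else 0) + c.2.+1%:R^-1.
pose I := {c : 'rV[rat]_n * nat | `[< @lrect R n (a c) (b c) `<=` (@tup2rv R n) @^-1` A >]}.
rewrite (_ : _ @^-1` _ = \bigcup_(c : I) @lrect R n (a (val c)) (b (val c))).
  apply: countable_bigcupT_measurable; first exact: countableP.
  by move=> c; exact: lrect_measurable.
apply/seteqP; split=> p.
- move=> /= Ap.
  have /nbhs_ballP[r /= r0 rA] := open_nbhs_nbhs (conj oA Ap).
  (* Half of [r]: the rational centre is within [1/(k+1)] of the point, and the box extends by the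
     same amount again. *)
  have [k] : exists k, k.+1%:R^-1 < r / 2.
    exists (Num.bound (r / 2)^-1).
    rewrite invf_plt ?posrE ?divr_gt0//.
    apply: (lt_le_trans (archi_boundP _)); first by rewrite invr_ge0 divr_ge0 ?ltW.
    by rewrite ler_nat.
  move=> kr.
  have hq i : exists q : rat, ratr q \in `]tup2rv p 0 i - k.+1%:R^-1, tup2rv p 0 i + k.+1%:R^-1[.
    apply: rat_in_itvoo; rewrite ltrBlDr -addrA ltrDl.
    by rewrite addr_gt0// invr_gt0.
  have [q hq'] := choice hq.
  pose c : 'rV[rat]_n * nat := (\row_i q i, k).
  have cA : `[< @lrect R n (a c) (b c) `<=` (@tup2rv R n) @^-1` A >].
    apply/asboolP; rewrite tup2rv_lrect => p' /= hp'; apply: rA.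
    rewrite -ball_normE /=.
    apply: norm_lt_coord => // i; have := hp' i; have := hq' i.
    rewrite /a /b /c /= valK in_itv /= !mxE => /andP[h1 h2] /andP[h3 h4].
    move: (k.+1%:R^-1) (ratr (q i)) (coord p i) (coord p' i) kr h1 h2 h3 h4.
    by move=> e x y z *; rewrite ltr_norml; apply/andP; split; lra.
  exists (exist _ c cA) => //=.
  rewrite tup2rv_lrect /= => i; rewrite /a /b /c /= valK mxE.
  have := hq' i; rewrite in_itv /= => /andP[h1 h2]; move: h1 h2.
  move: (k.+1%:R^-1) (ratr (q i)) (tup2rv p 0 i) => e x y *.
  by apply/andP; split; lra.
- by move=> [[c /asboolP cA] _ /=]; exact: cA.
Qed.

Lemma closed_preimage_measurable (A : set V) : closed A ->
  measurable ((@tup2rv R n) @^-1` A : set (projT2 (Mn R n))).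
Proof.
move=> cA; rewrite -[X in measurable X]setCK; apply: measurableC.
by apply: (@open_preimage_measurable (~` A)); rewrite openC.
Qed.

Lemma continuous_tup2rv_measurable (u : V -> R) : continuous u ->
  measurable_fun setT (u \o @tup2rv R n : projT2 (Mn R n) -> R).
Proof.
move=> cu; apply: (measurability _ (RGenOpens.measurableE R)) .
move=> _ [_ [a [b ->] <-]]; rewrite setTI comp_preimage.
apply: open_preimage_measurable.
by move/continuousP : cu; apply; exact: interval_open.
Qed.

Lemma compact_norm_bound (K : set V) : compact K ->
  exists N : nat, forall x, K x -> `|x| <= N%:R.
Proof.
move=> /compact_bounded [M [_ hM]].
exists (Num.bound (`|M| + 1)) => x Kx.
apply: (le_trans (hM (`|M| + 1) _ x Kx)); first by rewrite (le_lt_trans (ler_norm _))// ltrDl.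
by apply: ltW; apply: archi_boundP.
Qed.

Definition cube (N : R) : set V := [set x | `|x| <= N].

Lemma cube_measurable N : measurable ((@tup2rv R n) @^-1` (cube N) : set (projT2 (Mn R n))).
Proof.
apply: closed_preimage_measurable.
by apply: (closed_comp (f := fun x : V => `|x|) (D:= [set y| y<= N]));[ move=> x _; exact: norm_continuous | exact: closed_le].
Qed.

Lemma cubeE N : 0 <= N -> (@tup2rv R n) @^-1` (cube N) = @lrect R n (fun=> - N) (fun=> N).
Proof.
move=> N0; rewrite tup2rv_lrect; apply/seteqP; split=> p /= h.
- by move=> i; rewrite -ler_norml (le_trans (coord_le_norm _ i)).
- by apply: norm_le_coord => // i; rewrite ler_norml.
Qed.

Lemma lebn_cube_lty N : (lebn R n ((@tup2rv R n) @^-1` (cube N)) < +oo)%E.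
Proof.
(* [lebn_lrect] requires nondegenerate sides, whatever the sign of [N]. *)
apply: (@le_lt_trans _ _ (lebn R n ((@tup2rv R n) @^-1` (cube (`|N| + 1)))))%E.
  apply: le_measure; rewrite ?inE; [exact: cube_measurable..|].
  by move=> p; rewrite /cube /= => h; rewrite (le_trans h)// (le_trans (ler_norm _))// lerDl.
rewrite cubeE//.
by have /andP[] := @lebn_lrect R n (fun=> - (`|N| + 1)) (fun=> `|N| + 1)
   (fun=> gtrN (ltr_wpDl (normr_ge0 N) ltr01)).
Qed.

Lemma lebn_open_gt0 (A : set V) : open A -> A !=set0 ->
  (0 < lebn R n ((@tup2rv R n) @^-1` A))%E.
Proof.
move=> oA [x Ax].
have /nbhs_ballP[r /= r0 rA] := open_nbhs_nbhs (conj oA Ax).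
pose c (k : nat) : R := if (insub k : option 'I_n) is Some i then x 0 i else 0.
have /andP[h _] : (0 < lebn R n (@lrect R n (fun k => c k - r / 2)%R (fun k => c k + r / 2)%R) < +oo)%E.
  by apply: lebn_lrect => k; lra.
apply: (lt_le_trans h); apply: le_measure; rewrite ?inE.
- exact: lrect_measurable.
- exact: open_preimage_measurable.
rewrite tup2rv_lrect => p /= hp; apply: rA; rewrite -ball_normE /=.
apply: norm_lt_coord => // i; have := hp i; rewrite /c valK !mxE => /andP[h1 h2].
by rewrite ltr_norml; apply/andP; split; lra.
Qed.

End euclidean_space.

(** * Directional derivatives and integrals over R^n *)

Section directional_derivative.
Variables (R : realType) (V : normedModType R).

Lemma derivable_seq (u : V -> R) x v (h : nat -> R) :
  derivable u x v -> (forall k, h k != 0) -> h @ \oo --> 0 ->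
  (h k)^-1 * (u (x + h k *: v) - u x) @[k --> \oo] --> 'D_v u x.
Proof.
move=> du h0 hcvg.
have h' : h @ \oo --> 0^'.
  move=> A /= [r /= r0 rA].
  move/cvgrPdist_lt : hcvg => /(_ _ r0).
  apply: filterS => k hk; apply: rA => //=.
rewrite [X in X @ _ --> _](_ : _ =
    (fun t => t^-1 *: ((u \o shift x) (t *: v) - u x)) \o h).
  by apply: cvg_comp h' _; exact: du.
by apply/funext => k /=; rewrite (addrC x).
Qed.

Lemma is_derive_line (u : V -> R) x v (t : R) : derivable u (x + t *: v) v ->
  is_derive t 1 (fun s : R => u (x + s *: v)) ('D_v u (x + t *: v)).
Proof.
move=> du.
have e : (fun h : R => h^-1 *: (((fun s : R => u (x + s *: v)) \o shift t) (h *: (1 : R)) -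
      u (x + t *: v))) =
    (fun h => h^-1 *: ((u \o shift (x + t *: v)) (h *: v) - u (x + t *: v))).
  apply/funext => h /=; congr (_ *: (u _ - _)).
  by rewrite (_ : h *: (1 : R) = h) ?scalerDl 1?addrCA //; exact: mulr1.
by split; rewrite /derivable /derive e.
Qed.

(** Mean value theorem along the line; a negative [h] is treated by exchanging the two endpoints. *)
Lemma derivable_lipschitz_line (u : V -> R) v C :
  (forall x, derivable u x v) -> (forall x, `|'D_v u x| <= C) ->
  forall x h, `|u (x + h *: v) - u x| <= C * `|h|.
Proof.
move=> du uC.
have pos x h : 0 <= h -> `|u (x + h *: v) - u x| <= C * `|h|.
  move=> h0.
  have [|c _] := @MVT_segment _ (fun s : R => u (x + s *: v))
    (fun s => 'D_v u (x + s *: v)) 0 h h0 (fun t _ => is_derive_line (du _)).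
    apply: continuous_subspaceT => t.
    apply: differentiable_continuous; apply/derivable1_diffP.
    by have [] := is_derive_line (du (x + t *: v)).
  rewrite scale0r addr0 subr0 => ->.
  by rewrite normrM ler_wpM2r.
move=> x h; have [h0|h0] := leP 0 h; first exact: pos.
have e : x = (x + h *: v) + - h *: v by rewrite -addrA -scalerDl subrr scale0r addr0.
by rewrite distrC -(normrN h) {1}e pos// oppr_ge0 ltW.
Qed.

End directional_derivative.

Section integrals_on_Rn.
Variables (R : realType) (n : nat).
Local Notation V := 'rV[R]_n.
Local Notation tup := (@tup2rv R n).
Local Notation mu := (lebn R n).

Lemma bounded_support_integrable (F : V -> R) C N :
  measurable_fun setT (F \o tup) -> (forall x, `|F x| <= C) ->
  (forall x, N < `|x| -> F x = 0) -> mu.-integrable setT (fun p => (F (tup p))%:E).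
Proof.
move=> mF FC F0.
rewrite (_ : (fun p => _) = (EFin \o (F \o tup)) \_ (tup @^-1` (cube N))).
  apply/(integrable_mkcond _ (@cube_measurable R n N)).
  apply: measurable_bounded_integrable; [exact: cube_measurable| exact: lebn_cube_lty| |].
    exact: measurable_funS mF.
  by exists C; split; [exact: num_real|move=> M /ltW CM p _; exact: (le_trans (FC _) CM)].
apply/funext => p; rewrite patchE; case: ifPn => //.
by rewrite notin_setE /cube /= => /negP; rewrite -ltNge => /F0 ->.
Qed.

Lemma integral_translation (F : V -> R) (j : 'I_n) h :
  measurable_fun setT (F \o tup) ->
  (\int[mu]_p (F (tup p + h *: ebasis R j))%:E = \int[mu]_p (F (tup p))%:E)%E.
Proof.
move=> mF.
pose s (k : nat) := if k == j then h else 0.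
have e p : (F (tup p + h *: ebasis R j))%:E = (EFin \o F \o tup) (shiftn s p).
  rewrite /= tup2rv_shiftn; congr (F (_ + _))%:E.
  by apply/rowP => i; rewrite /ebasis !mxE eqxx /s -(inj_eq val_inj); case: ifP; rewrite ?mulr1 ?mulr0.
under eq_integral do rewrite e.
have mE : measurable_fun setT (EFin \o F \o tup) by exact/measurable_EFinP.
rewrite integralE [RHS]integralE; congr (_ - _)%E.
- transitivity (\int[mu]_p ((EFin \o F \o tup)^\+ (shiftn s p)))%E.
    by apply: eq_integral => p _; rewrite !funeposE.
  exact: (lebn_translation s (measurable_funepos mE) (funepos_ge0 _)).
- transitivity (\int[mu]_p ((EFin \o F \o tup)^\- (shiftn s p)))%E.
    by apply: eq_integral => p _; rewrite !funenegE.
  exact: (lebn_translation s (measurable_funeneg mE) (funeneg_ge0 _)).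
Qed.

Lemma intRn_vanish_off (A : set V) (F : V -> R) :
  (forall x, ~ A x -> F x = 0) ->
  (intRn A (fun x => (F x)%:E) = \int[mu]_p (F (tup p))%:E)%E.
Proof.
move=> F0; rewrite /intRn integral_mkcond; apply: eq_integral => p _.
by rewrite patchE; case: ifPn => //; rewrite notin_setE => /F0 ->.
Qed.

Lemma measurable_locally_bounded (D : set V) (u : V -> R) :
  measurable_fun setT (u \o tup) ->
  (forall N, exists M, forall x, `|x| <= N -> `|u x| <= M) -> loc_integrable D u.
Proof.
move=> mu_ bu K cK _.
have [N hN] := compact_norm_bound cK.
have mK : measurable (tup @^-1` K).
  by apply: closed_preimage_measurable; apply: compact_closed => //; exact: norm_hausdorff.
apply: (@measurable_bounded_integrable _ _ _ _ (u \o tup)) => //.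
- apply: le_lt_trans (@lebn_cube_lty R n N%:R).
  by apply: le_measure; rewrite ?inE//; [exact: cube_measurable|move=> p; exact: hN].
- exact: measurable_funS mu_.
- have [M hM] := bu N%:R.
  exists M; split; first exact: num_real.
  by move=> M' /ltW MM' p Kp /=; apply: (le_trans (hM _ (hN _ Kp))).
Qed.

Lemma continuous_bounded_cube (u : V -> R) : continuous u ->
  forall N, exists M, forall x, `|x| <= N -> `|u x| <= M.
Proof.
move=> cu N.
have cc : compact (@cube R n N).
  apply: bounded_closed_compact.
    by exists N; split; [exact: num_real|move=> M /ltW NM x xN; exact: le_trans NM].
  by apply: (closed_comp (f := fun x : V => `|x|) (D:= [set y| y<= N]));
    [move=> x _; exact: norm_continuous | exact: closed_le].
have /compact_bounded[M [_ hM]] := continuous_compact (continuous_subspaceT cu) cc.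
exists (`|M| + 1) => x xN; apply: hM; last by exists x.
by rewrite (le_lt_trans (ler_norm _))// ltrDl.
Qed.

End integrals_on_Rn.

(** * Weak derivatives of Lipschitz functions *)

Section weak_derivative.
Variables (R : realType) (n : nat).
Local Notation V := 'rV[R]_n.
Local Notation tup := (@tup2rv R n).
Local Notation mu := (lebn R n).

(** Off its closed support [phi] vanishes on a whole neighbourhood, so its derivatives vanish there
    as well. *)
Lemma test_fun_support (D : set V) (phi : V -> R) : test_fun D phi ->
  exists2 S : set V, S `<=` D /\ (exists N, forall x, S x -> `|x| <= N) &
    forall x, ~ S x -> phi x = 0 /\ forall j, 'D_(ebasis R j) phi x = 0.
Proof.
move=> [_ [_ [cS SD]]]; exists (closure [set x | phi x != 0]).
  by split=> //; have [N hN] := compact_norm_bound cS; exists N%:R.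
move=> x xS; have near0 : \near x, phi x = cst 0 x.
  have oS : open (~` closure [set x | phi x != 0]) by rewrite openC; exact: closed_closure.
  have : nbhs x (~` closure [set x | phi x != 0]) by apply: open_nbhs_nbhs.
  apply: filterS => y yS; apply/eqP/negP => /negP y0; apply: yS.
  exact: subset_closure.
split; first exact: (nbhs_singleton near0).
by move=> j; rewrite (near_eq_derive _ near0) derive_cst.
Qed.

Lemma cube_indic_integrable c N :
  mu.-integrable setT (fun p => (c * \1_(@cube R n N) (tup p))%:E).
Proof.
apply: (@bounded_support_integrable _ _ (fun x => c * \1_(@cube R n N) x) `|c| N).
- apply: (@measurable_funM _ _ _ _ (cst c) (\1_(tup @^-1` cube N))) => //.
  exact: (measurable_indic (@cube_measurable R n N)).
- move=> x; rewrite normrM ler_piMr// indicE.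
  by case: (_ \in _); rewrite ?normr1 ?normr0.
- move=> x Nx; rewrite indicE memNset ?mulr0// /cube /=.
  by apply/negP; rewrite -ltNge.
Qed.

Lemma shift_continuous (c : V) : continuous (fun x : V => x + c).
Proof.
move=> x; apply: (@cvgD _ _ _ (nbhs x) _ id (cst c) x c); first exact: cvg_id.
exact: cvg_cst.
Qed.

(* Translation invariance moves the difference quotient from [phi] to [u]; both
   sides then converge by dominated convergence. *)
Lemma lipschitz_weak_derivative (D : set V) (u g phi : V -> R) (j : 'I_n) L (Z : set V) :
  continuous u -> (forall x h, `|u (x + h *: ebasis R j) - u x| <= L * `|h|) ->
  measurable_fun setT (g \o tup) -> (forall x, `|g x| <= L) ->
  Rn_null Z ->
  (forall x, ~ Z x -> derivable u x (ebasis R j) /\ 'D_(ebasis R j) u x = g x) ->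
  test_fun D phi ->
  intRn D (fun x => (u x * 'D_(ebasis R j) phi x)%:E) =
    (- intRn D (fun x => (g x * phi x)%:E))%E.
Proof.
move=> cu uL mg gL nZ ug tphi.
have [S [SD [N SN]] S0] := test_fun_support tphi.
pose e := ebasis R j; pose dphi := 'D_e phi.
have cphi : continuous phi by case: tphi => /(_ [::]).
have dphi_ex x : derivable phi x e by have [_ [dp _]] := tphi; exact: (dp [::]).
have cdphi : continuous dphi by have [cp _] := tphi; exact: (cp [:: j]).
have SnN x : N < `|x| -> ~ S x by move=> Nx /SN; rewrite leNgt Nx.
have glob (v : V -> R) : continuous v -> (forall x, ~ S x -> v x = 0) ->
    exists2 C, 0 <= C & forall x, `|v x| <= C.
  move=> cv v0; have [M hM] := continuous_bounded_cube cv N.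
  exists `|M| => // x; have [xN|Nx] := leP `|x| N.
    exact: (le_trans (hM _ xN) (ler_norm _)).
  by rewrite v0 ?normr0//; exact: SnN.
have [C C0 phiC] := glob _ cphi (fun x Sx => (S0 x Sx).1).
have [C' C'0 dphiC] := glob _ cdphi (fun x Sx => (S0 x Sx).2 j).
have phiL := derivable_lipschitz_line dphi_ex dphiC.
have e1 : `|e| <= 1.
  apply: norm_le_coord => // i; rewrite /e /ebasis mxE.
  by case: (_ && _); rewrite ?normr1 ?normr0.
have L0 : 0 <= L by exact: le_trans (gL 0).
pose h k : R := k.+1%:R^-1.
have h0 k : 0 < h k by rewrite invr_gt0.
have h1 k : h k <= 1 by rewrite invf_le1// ler1n.
(* The steps satisfy [h k <= 1] and [e] has norm at most 1, so all difference quotients of [phi] are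
   supported in the cube of radius [N + 1]. *)
have [M uM] := continuous_bounded_cube cu (N + 1).
have M0 : 0 <= `|M| by [].
(* [A] carries the forward quotient of [phi] and [B] the backward quotient of [u]. Since [A] is [F]
   shifted by [h k *: e] minus [G], and [B = F - G], translation invariance gives them equal
   integrals. *)
pose A k (x : V) : R := u x * ((h k)^-1 * (phi (x + h k *: e) - phi x)).
pose B k (x : V) : R := ((h k)^-1 * (u (x + - h k *: e) - u x)) * phi x.
pose F k (x : V) : R := (h k)^-1 * (u (x + - h k *: e) * phi x).
pose G k (x : V) : R := (h k)^-1 * (u x * phi x).
have mc (v : V -> R) : continuous v -> measurable_fun setT (v \o tup).
  exact: continuous_tup2rv_measurable.
have csh (v : V -> R) (c : V) : continuous v -> continuous (fun x : V => v (x + c)).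
  by move=> cv x; apply: (@continuous_comp _ _ _ (fun y : V => y + c) v); [exact: shift_continuous|exact: cv].
have cM (f1 f2 : V -> R) : continuous f1 -> continuous f2 ->
    continuous (fun x : V => f1 x * f2 x).
  by move=> cf1 cf2 x; exact: (cvgM (cf1 x) (cf2 x)).
have cDf (f1 f2 : V -> R) : continuous f1 -> continuous f2 ->
    continuous (fun x : V => f1 x - f2 x).
  by move=> cf1 cf2 x; exact: (cvgB (cf1 x) (cf2 x)).
have cc (r : R) : continuous (fun _ : V => r) by exact: cst_continuous.
have cF k : continuous (F k) := cM _ _ (cc _) (cM _ _ (csh _ _ cu) cphi).
have cG k : continuous (G k) := cM _ _ (cc _) (cM _ _ cu cphi).
have cA k : continuous (A k) := cM _ _ cu (cM _ _ (cc _) (cDf _ _ (csh _ _ cphi) cphi)).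
have cB k : continuous (B k) := cM _ _ (cM _ _ (cc _) (cDf _ _ (csh _ _ cu) cu)) cphi.
have intc v : continuous v -> (forall x, ~ S x -> v x = 0) ->
    mu.-integrable setT (fun p => (v (tup p))%:E).
  move=> cv v0; have [K _ vK] := glob v cv v0.
  apply: (@bounded_support_integrable _ _ v K N) => //; first exact: mc.
  by move=> x /SnN /v0.
have F0 k x : ~ S x -> F k x = 0 by move=> /S0[p0 _]; rewrite /F p0 !mulr0.
have G0 k x : ~ S x -> G k x = 0 by move=> /S0[p0 _]; rewrite /G p0 !mulr0.
have iF k : mu.-integrable setT (fun p => (F k (tup p))%:E) by exact: intc (F0 k).
have iG k : mu.-integrable setT (fun p => (G k (tup p))%:E) by exact: intc (G0 k).
have Nh k (x : V) : N + 1 < `|x| -> N < `|x + h k *: e|.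
  move=> Nx; have : `|x| <= `|x + h k *: e| + `|h k *: e|.
    by rewrite -{1}[x](addrK (h k *: e)) ler_normB.
  have : `|h k *: e| <= 1.
    by rewrite normrZ mulr_ile1// gtr0_norm.
  move: Nx; move: `|x| `|x + _| `|_ *: e| => a b c; lra.
have iFs k : mu.-integrable setT (fun p => (F k (tup p + h k *: e))%:E).
  have [K _ FK] := glob _ (cF k) (F0 k).
  apply: (@bounded_support_integrable _ _ (fun x => F k (x + h k *: e)) K (N + 1)) => //.
    by apply: mc; exact: csh.
  by move=> x /Nh /SnN /F0.
have AB k : (\int[mu]_p (A k (tup p))%:E = \int[mu]_p (B k (tup p))%:E)%E.
  transitivity (\int[mu]_p ((F k (tup p + h k *: e))%:E - (G k (tup p))%:E))%E.
    apply: eq_integral => p _; rewrite -EFinB; congr EFin.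
    rewrite /A /F /G -addrA -scalerDl subrr scale0r addr0; ring.
  rewrite (@integralB_EFin _ _ _ mu setT (fun p => F k (tup p + h k *: e))
    (fun p => G k (tup p)) measurableT (iFs k) (iG k)).
  rewrite integral_translation; last exact: (mc _ (cF k)).
  rewrite -(@integralB_EFin _ _ _ mu setT (fun p => F k (tup p))
    (fun p => G k (tup p)) measurableT (iF k) (iG k)).
  apply: eq_integral => p _; rewrite -EFinB; congr EFin.
  by rewrite /B /F /G; ring.
have limA : (\int[mu]_p (A k (tup p))%:E)%E @[k --> \oo] -->
    (\int[mu]_p (u (tup p) * dphi (tup p))%:E)%E.
  have bA := cube_indic_integrable (`|M| * C') (N + 1).
  have mA k : measurable_fun setT (fun p => (A k (tup p))%:E).
    by apply/measurable_EFinP; exact: (mc _ (cA k)).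
  have mA' : measurable_fun setT (fun p => (u (tup p) * dphi (tup p))%:E).
    by apply/measurable_EFinP; exact: (mc _ (cM _ _ cu cdphi)).
  have cvgA : {ae mu, forall p, setT p -> (A k (tup p))%:E @[k --> \oo] -->
      (u (tup p) * dphi (tup p))%:E}.
    apply: aeW => p _; apply: cvg_EFin; first exact: nearW.
    apply: cvgM; first exact: cvg_cst.
    apply: derivable_seq => //; first by move=> k; rewrite gt_eqF.
    exact: cvg_harmonic.
  have leA : {ae mu, forall p k, setT p ->
      (`|(A k (tup p))%:E| <= (`|M| * C' * \1_(cube (N + 1)) (tup p))%:E)%E}.
    apply: aeW => p k _; rewrite abse_EFin lee_fin.
    have [xN|Nx] := leP `|tup p| (N + 1).
      rewrite indicE mem_set//= mulr1 /A normrM ler_pM//.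
        exact: (le_trans (uM _ xN) (ler_norm _)).
      rewrite normrM normfV (gtr0_norm (h0 k)) ler_pdivrMl// mulrC.
      by rewrite (le_trans (phiL _ _))// (gtr0_norm (h0 k)).
    rewrite /A; have [-> _] := S0 _ (SnN _ (Nh k _ Nx)).
    have [|-> _] := S0 (tup p); first by apply: SnN; rewrite (lt_trans _ Nx)// ltrDl.
    by rewrite subrr !mulr0 normr0 mulr_ge0// mulr_ge0.
  by have [] := dominated_convergence measurableT mA mA' cvgA bA leA.
have limB : (\int[mu]_p (B k (tup p))%:E)%E @[k --> \oo] -->
    (\int[mu]_p (- (g (tup p) * phi (tup p)))%:E)%E.
  have bB := cube_indic_integrable (L * C) N.
  have mB k : measurable_fun setT (fun p => (B k (tup p))%:E).
    by apply/measurable_EFinP; exact: (mc _ (cB k)).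
  have mB' : measurable_fun setT (fun p => (- (g (tup p) * phi (tup p)))%:E).
    apply/measurable_EFinP; apply: measurableT_comp => //.
    exact: (measurable_funM mg (mc _ cphi)).
  have cvgB : {ae mu, forall p, setT p -> (B k (tup p))%:E @[k --> \oo] -->
      (- (g (tup p) * phi (tup p)))%:E}.
    have [Z' [mZ' Z'0 ZZ']] := nZ.
    exists Z'; split=> // p; apply: contra_notP => nZp _.
    have /ug[du <-] : ~ Z (tup p) by move=> Zp; apply: nZp; exact: ZZ'.
    apply: cvg_EFin; first exact: nearW.
    rewrite -mulNr; apply: cvgM; last exact: cvg_cst.
    (* Rewritten with the step [- h k], the backward quotient is minus a genuine difference
       quotient; this is the sign of the integration by parts. *)
    rewrite [X in X @ _ --> _](_ : _ =
      (fun k => - ((- h k)^-1 * (u (tup p + - h k *: e) - u (tup p))))); last first.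
      by apply/funext => k; rewrite invrN mulNr opprK.
    apply: cvgN; apply: derivable_seq => //; first by move=> k; rewrite oppr_eq0 gt_eqF.
    by rewrite -oppr0; apply: cvgN; exact: cvg_harmonic.
  have leB : {ae mu, forall p k, setT p ->
      (`|(B k (tup p))%:E| <= (L * C * \1_(cube N) (tup p))%:E)%E}.
    apply: aeW => p k _; rewrite abse_EFin lee_fin.
    have [xN|Nx] := leP `|tup p| N; last first.
      rewrite /B; have [-> _] := S0 _ (SnN _ Nx).
      by rewrite mulr0 normr0 mulr_ge0// mulr_ge0.
    rewrite indicE mem_set//= mulr1 /B normrM ler_pM//.
    rewrite normrM normfV (gtr0_norm (h0 k)) ler_pdivrMl// mulrC.
    by rewrite (le_trans (uL _ _))// normrN (gtr0_norm (h0 k)).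
  by have [] := dominated_convergence measurableT mB mB' cvgB bB leB.
rewrite intRn_vanish_off; last first.
  by move=> x Dx; have [_ ->] := S0 x (fun Sx => Dx (SD _ Sx)); rewrite mulr0.
rewrite intRn_vanish_off; last first.
  by move=> x Dx; have [-> _] := S0 x (fun Sx => Dx (SD _ Sx)); rewrite mulr0.
rewrite -[RHS]integralN; last first.
  apply: integrable_add_def => //.
  apply: (@bounded_support_integrable _ _ (fun x => g x * phi x) (L * C) N).
  - exact: (measurable_funM mg (mc _ cphi)).
  - by move=> x; rewrite normrM ler_pM.
  - by move=> x /SnN/S0[-> _]; rewrite mulr0.
have limAB : (\int[mu]_p (A k (tup p))%:E)%E @[k --> \oo] -->
    (\int[mu]_p (- (g (tup p) * phi (tup p)))%:E)%E.
  by rewrite [X in X @ _ --> _](funext AB).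
exact: (cvg_unique _ limA limAB).
Qed.

End weak_derivative.

(** * Stretches of the last coordinate *)

Section derivatives_in_rows.
Variables (R : realType) (V : normedModType R).

(** A directional derivative only sees the restriction to a line, so derivatives of stretches reduce
    to one variable. *)
Lemma line_is_derive (W : normedModType R) (u : V -> W) x v d :
  is_derive (0 : R) (1 : R) (fun s : R => u (x + s *: v)) d -> is_derive x v u d.
Proof.
have e : (fun h : R => h^-1 *: (((fun s : R => u (x + s *: v)) \o shift 0) (h *: (1 : R)) -
      u (x + 0 *: v))) =
    (fun h => h^-1 *: ((u \o shift x) (h *: v) - u x)).
  apply/funext => h /=; rewrite addr0 scale0r addr0 (addrC x).
  by rewrite (_ : h *: (1 : R) = h)//; exact: mulr1.
by move=> [/= du dE]; split; move: du dE; rewrite /derivable /derive e.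
Qed.

Lemma is_derive_rows k (f : V -> 'rV[R]_k) x v (d : 'rV[R]_k) :
  (forall i, is_derive x v (fun y => f y 0 i) (d 0 i)) -> is_derive x v f d.
Proof.
move=> fd.
have h : h^-1 *: ((f \o shift x) (h *: v) - f x) @[h --> 0^'] --> d.
  apply/cvgrPdist_lt => eps eps0.
  have : \forall h \near 0^', forall i : 'I_k,
      `|d 0 i - h^-1 *: (((fun y => f y 0 i) \o shift x) (h *: v) - f x 0 i)| < eps.
    apply: filter_forall => i; have [du dE] := fd i.
    move: eps eps0; apply/cvgrPdist_lt; rewrite -dE; exact: du.
  by apply: filterS => t ht; apply: norm_lt_coord => // i; have := ht i; rewrite !mxE.
split; first by apply/cvg_ex; exists d.
exact: cvg_lim h.
Qed.

End derivatives_in_rows.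

Section stretch.
Variables (R : realType) (m : nat).
Local Notation V := 'rV[R]_m.+1.
Local Notation tup := (@tup2rv R m.+1).
Local Notation top := (@ord_max m).

Definition stretch (v : R -> R) (x : V) : V :=
  \row_i (if i == top then v (x 0 i) else x 0 i).

(** What a function of one variable must satisfy for its stretch to be admissible. The lower
    Lipschitz bound gives injectivity and a continuous inverse; the upper one gives, with [dv], the
    weak derivatives. [dv] is the derivative of [v] only off the null set [Z], which will hold the
    kinks. *)
Record profile (v dv : R -> R) (Z : set R) (c C : R) : Prop := Profile {
  profile_gt0 : 0 < c ;
  profile_bilip : forall y z, c * `|y - z| <= `|v y - v z| <= C * `|y - z| ;
  profile_meas : measurable_fun setT dv ;
  profile_bound : forall y, `|dv y| <= C ;
  profile_null : measurable Z /\ lebesgue_measure Z = 0%E ;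
  profile_derive : forall y, ~ Z y -> is_derive y 1 v (dv y) }.

Lemma last_coord (p : projT2 (Mn R m.+1)) : tup p 0 top = p.2.
Proof. by rewrite tup2rvE coordS eqxx. Qed.

Lemma last_coord_null (Z : set R) : measurable Z -> lebesgue_measure Z = 0%E ->
  measurable (tup @^-1` [set x | Z (x 0 top)]) /\
  lebn R m.+1 (tup @^-1` [set x | Z (x 0 top)]) = 0%E.
Proof.
move=> mZ Z0.
have -> : tup @^-1` [set x | Z (x 0 top)] = setT `*` Z.
  apply/seteqP; split=> p /=; rewrite last_coord; first by split.
  by case.
split; first exact: measurableX.
have -> : lebn R m.+1 (setT `*` Z) = (lebn R m setT * lebesgue_measure Z)%E.
  exact: (@product_measure1E _ _ _ _ _ (lebn R m) lebesgue_measure).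
(* The first factor may be infinite; the product is 0 by the convention for [+oo * 0]. *)
by rewrite Z0 mule0.
Qed.

Lemma stretch_coord_is_derive v (x : V) a (i j : 'I_m.+1) :
  is_derive (x 0 top) 1 v a ->
  is_derive x (ebasis R j) (fun y => stretch v y 0 i)
    (if i == j then (if i == top then a else 1) else 0).
Proof.
move=> va; apply: line_is_derive.
have [<-|ij] := eqVneq i j; last first.
  rewrite [X in is_derive _ _ X _](_ : _ = cst (stretch v x 0 i)).
    exact: is_derive_cst.
  by apply/funext => s; rewrite /stretch /ebasis !mxE (negbTE ij) andbF mulr0 addr0.
have [iT|iT] := eqVneq i top.
  rewrite [X in is_derive _ _ X _](_ : _ = fun s => v (x 0 i + s *: (1 : R))).
    have va' : is_derive (x 0 i + 0 *: (1 : R)) 1 v a by rewrite scale0r addr0 iT.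
    have := is_derive_line (@ex_derive _ _ _ _ _ _ _ va').
    by rewrite (@derive_val _ _ _ _ _ _ _ va').
  by apply/funext => s; rewrite /stretch /ebasis !mxE iT !eqxx.
rewrite [X in is_derive _ _ X _](_ : _ = (cst (x 0 i) + id)).
  by rewrite -[1 in X in is_derive _ _ _ X]add0r; exact: is_deriveD.
by apply/funext => s; rewrite /stretch /ebasis !mxE (negbTE iT) !eqxx mulr1.
Qed.

Lemma stretch_is_derive v (x : V) a (j : 'I_m.+1) :
  is_derive (x 0 top) 1 v a ->
  is_derive x (ebasis R j) (stretch v)
    (\row_i (if i == j then (if i == top then a else 1) else 0)).
Proof.
by move=> va; apply: is_derive_rows => i; rewrite mxE; exact: stretch_coord_is_derive.
Qed.

Section profile.
Variables (v dv : R -> R) (Z : set R) (c C : R).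
Hypothesis pv : profile v dv Z c C.

(** The other coordinates move with constant 1, whence the maximum with 1 here and the minimum with
    1 in the lower bound. *)
Let C' := Num.max C 1.

Lemma stretch_lipschitz (x y : V) : `|stretch v x - stretch v y| <= C' * `|x - y|.
Proof.
have C'0 : 0 <= C' by rewrite le_max ler01 orbT.
apply: norm_le_coord => [|i]; first by rewrite mulr_ge0.
apply: (@le_trans _ _ (C' * `|x 0 i - y 0 i|)); last first.
  by rewrite ler_wpM2l//; have := coord_le_norm (x - y) i; rewrite !mxE.
rewrite !mxE; case: ifP => _.
  have /andP[_ h] := profile_bilip pv (x 0 i) (y 0 i).
  by apply: (le_trans h); rewrite ler_wpM2r// le_max lexx.
by rewrite ler_peMl// le_max lexx orbT.
Qed.

Lemma stretch_colipschitz (x y : V) :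
  Num.min c 1 * `|x - y| <= `|stretch v x - stretch v y|.
Proof.
have c0 : 0 < Num.min c 1 by rewrite lt_min ltr01 (profile_gt0 pv).
rewrite mulrC -ler_pdivlMr//; apply: norm_le_coord => [|i].
  by rewrite divr_ge0// ltW.
rewrite ler_pdivlMr// mulrC; apply: le_trans (coord_le_norm _ i).
rewrite !mxE; case: ifP => _.
  have /andP[h _] := profile_bilip pv (x 0 i) (y 0 i).
  by apply: le_trans h; rewrite ler_wpM2r// ge_min lexx.
by rewrite ler_piMl// ge_min lexx orbT.
Qed.

Lemma stretch_continuous : continuous (stretch v).
Proof.
have C'0 : 0 < C' by rewrite lt_max ltr01 orbT.
move=> x; apply/(@cvgrPdist_lt _ _ _ (nbhs x) _ (stretch v)) => eps eps0.
apply/nbhs_ballP; exists (eps / C') => /=; first by rewrite divr_gt0.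
move=> y; rewrite -ball_normE /= ltr_pdivlMr// mulrC => h.
exact: le_lt_trans (stretch_lipschitz _ _) h.
Qed.

Lemma stretch_homeo_into (D : set V) : homeo_into D (stretch v).
Proof.
have c0 : 0 < Num.min c 1 by rewrite lt_min ltr01 (profile_gt0 pv).
have inj x y : stretch v x = stretch v y -> x = y.
  move=> e; have := stretch_colipschitz x y; rewrite e subrr normr0.
  by rewrite pmulr_rle0// normr_le0 subr_eq0 => /eqP.
split; first exact/continuous_subspaceT/stretch_continuous.
split; first by move=> x y _ _; exact: inj.
(* The inverse is chosen pointwise; its continuity on the image comes from [stretch_colipschitz]. *)
pose g y := xget 0 [set x | stretch v x = y].
have gK x : g (stretch v x) = x.
  by rewrite /g; case: xgetP => [z _ /= /inj|/(_ x) /= []].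
exists g; split; first by move=> x _.
apply/subspace_continuousP => _ [x Dx <-]; rewrite /from_subspace gK.
apply/(@cvgrPdist_lt _ _ _ (within _ (nbhs (stretch v x)))) => eps eps0.
rewrite near_withinE.
apply/nbhs_ballP; exists (eps * Num.min c 1) => /=; first by rewrite mulr_gt0.
move=> y xy [z Dz zy]; move: xy; rewrite -zy gK -ball_normE /= => h.
have := le_lt_trans (stretch_colipschitz x z) h.
by rewrite mulrC ltr_pM2r.
Qed.

Lemma stretch_W11loc (D : set V) : W11loc D (stretch v).
Proof.
have mlast : measurable_fun setT ((fun x : V => x 0 top) \o tup).
  rewrite (_ : _ \o _ = fun p => coord p m); first exact: coord_measurable.
  by apply/funext => p /=; rewrite tup2rvE.
have cs i : continuous (fun x : V => stretch v x 0 i).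
  move=> x; apply: (@continuous_comp _ _ _ (stretch v) (fun y : V => y 0 i)).
    exact: stretch_continuous.
  exact: coord_continuous.
move=> i; split.
  apply: measurable_locally_bounded; first exact: (continuous_tup2rv_measurable (cs i)).
  exact: continuous_bounded_cube.
move=> j.
pose g (x : V) := if i == j then (if i == top then dv (x 0 top) else 1) else 0.
have mg : measurable_fun setT (g \o tup).
  rewrite /g; case: (i == j) => /=; last exact: measurable_cst.
  case: (i == top) => /=; last exact: measurable_cst.
  exact: (measurableT_comp (profile_meas pv) mlast).
have C1 : 1 <= C' by rewrite le_max lexx orbT.
have C0 : 0 <= C' by exact: le_trans C1.
have gC x : `|g x| <= C'.
  rewrite /g; case: ifP => _; last by rewrite normr0.
  case: ifP => _; last by rewrite normr1.
  by apply: (le_trans (profile_bound pv _)); rewrite le_max lexx.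
exists g; split.
  by apply: measurable_locally_bounded => // N; exists C'.
have [mZ Z0] := profile_null pv.
have [mZ' Z'0] := last_coord_null mZ Z0.
move=> phi; apply: (@lipschitz_weak_derivative _ _ D _ g phi j C'
   [set x | Z (x 0 top)]) => //.
- move=> x h; have := coord_le_norm (stretch v (x + h *: ebasis R j) - stretch v x) i.
  rewrite mxE [(- _ : V) _ _]mxE => /le_trans; apply.
  apply: (le_trans (stretch_lipschitz _ _)).
  rewrite addrC addKr normrZ ler_wpM2l// ler_piMr//.
  apply: norm_le_coord => // k; rewrite /ebasis mxE.
  by case: (_ && _); rewrite ?normr1 ?normr0.
- by exists (tup @^-1` [set x : V | Z (x 0 top)]); split.
- move=> x /= nZ.
  by have [] := stretch_coord_is_derive i j (profile_derive pv nZ).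
Qed.
End profile.
End stretch.

(** * Dilatation of a stretch *)

Section dilatation_of_stretch.
Variables (R : realType) (m : nat).
Hypothesis m_gt0 : (0 < m)%N.
Local Notation V := 'rV[R]_m.+1.
Local Notation top := (@ord_max m).

Definition stretch_diag (a : R) : V := \row_i (if i == top then a else 1).

Lemma jac_stretch (v : R -> R) (x : V) (a : R) : is_derive (x 0 top) 1 v a ->
  has_partials (stretch v) x /\ jac (stretch v) x = diag_mx (stretch_diag a).
Proof.
move=> va; split=> [j|]; first by have [] := stretch_is_derive j va.
apply/matrixP => i j; rewrite !mxE (@derive_val _ _ _ _ _ _ _ (stretch_is_derive j va)) !mxE.
by have [->|] := eqVneq i j; rewrite ?mulr1n ?mulr0n.
Qed.

Lemma det_stretch_diag a : \det (diag_mx (stretch_diag a)) = a.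
Proof.
rewrite det_diag (bigD1 top)//= mxE eqxx big1 ?mulr1// => i iT.
by rewrite mxE (negbTE iT).
Qed.

(** The largest diagonal entry is attained at a basis vector: [top] if [1 < a], and otherwise
    [ord0], which differs from [top] because [0 < m]. *)
Lemma opnorm_stretch_diag a : 0 <= a ->
  opnorm (diag_mx (stretch_diag a)) = Num.max a 1.
Proof.
move=> a0; set b := Num.max a 1.
have b0 : 0 <= b by rewrite le_max ler01 orbT.
have euclE (h : 'cV[R]_m.+1) : eucl h = Num.sqrt (\sum_i h i 0 ^+ 2).
  by congr Num.sqrt; apply: eq_bigr => i _; rewrite big_ord1.
pose A := [set eucl (diag_mx (stretch_diag a) *m h) | h in [set h : 'cV[R]_m.+1 | eucl h = 1]].
have ub : ubound A b.
  move=> _ [h /= h1 <-]; rewrite euclE -[b]mulr1 -h1 euclE.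
  rewrite -{1}(ger0_norm b0) -sqrtr_sqr -sqrtrM ?sqr_ge0//; apply: ler_wsqrtr.
  rewrite mulr_sumr; apply: ler_sum => i _.
  rewrite mul_diag_mx !mxE exprMn ler_wpM2r ?sqr_ge0//.
  by rewrite lerXn2r ?nnegrE//; case: ifP => _; rewrite ?le_max ?lexx ?orbT.
have att (k : 'I_m.+1) : A (if k == top then a else 1).
  have e1 : eucl (delta_mx k 0 : 'cV[R]_m.+1) = 1.
    rewrite euclE (bigD1 k)//= big1 => [|i ik]; rewrite !mxE.
      by rewrite !eqxx expr1n addr0 sqrtr1.
    by rewrite (negbTE ik) expr0n.
  exists (delta_mx k 0) => //.
  rewrite (_ : _ *m _ = (if k == top then a else 1) *: delta_mx k 0).
    rewrite euclE (eq_bigr (fun i => (if k == top then a else 1) ^+ 2 *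
      (delta_mx k 0 : 'cV[R]_m.+1) i 0 ^+ 2)) => [|i _]; last by rewrite mxE exprMn.
    rewrite -mulr_sumr sqrtrM ?sqr_ge0// -euclE e1 mulr1 sqrtr_sqr ger0_norm//.
    by case: ifP.
  apply/matrixP => i j; rewrite mul_diag_mx !mxE.
  by have [->|] := eqVneq i k; rewrite ?mulr0.
have Ab : A b.
  rewrite /b; case: (leP a 1) => _; last by have := att top; rewrite eqxx.
  have := att ord0; rewrite -val_eqE /= eq_sym.
  by rewrite (gtn_eqF m_gt0).
apply/eqP; rewrite eq_le; apply/andP; split.
- by apply: ge_sup => //; exists b.
- by apply: ub_le_sup => //; exists b.
Qed.

(** The determinant vanishes but the Jacobian matrix does not: its first diagonal entry is 1, as
    [ord0] is not [top]. So [Kf] is [+oo], and so is its positive power. *)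
Lemma Pf_stretch_degenerate (v : R -> R) (x : V) : is_derive (x 0 top) 1 v 0 ->
  Pf (stretch v) x = +oo%E.
Proof.
move=> /jac_stretch[hp hj]; rewrite /Pf /Kf (asboolT hp) hj det_stretch_diag eqxx /=.
rewrite ifF; first by rewrite poweRyr// subn1 invr_eq0 pnatr_eq0 -lt0n.
apply/negP => /eqP/matrixP/(_ ord0 ord0); rewrite !mxE eqxx mulr1n -val_eqE /=.
by rewrite (ltn_eqF m_gt0) => /eqP; rewrite oner_eq0.
Qed.

Lemma Pf_stretch (v : R -> R) (x : V) (a : R) : is_derive (x 0 top) 1 v a -> 0 < a ->
  Pf (stretch v) x = ((Num.max a 1 ^+ m.+1 / a) `^ (m%:R^-1))%:E.
Proof.
move=> /jac_stretch[hp hj] a0; rewrite /Pf /Kf (asboolT hp) hj det_stretch_diag gt_eqF//=.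
by rewrite opnorm_stretch_diag ?ltW// gtr0_norm// subn1.
Qed.

Lemma powR_root (t : R) : 0 <= t -> (t ^+ m) `^ (m%:R^-1) = t.
Proof.
move=> t0; rewrite -powR_mulrn// -powRrM mulfV ?pnatr_eq0 -?lt0n//.
by rewrite powRr1.
Qed.

(** Norm and determinant both equal [a], so [Kf] is [a ^ m.+1 / a = a ^ m], and the exponent [1/m]
    undoes the power. *)
Lemma Pf_stretch_expand (v : R -> R) (x : V) (a : R) : is_derive (x 0 top) 1 v a -> 1 <= a ->
  Pf (stretch v) x = a%:E.
Proof.
move=> va a1; have a0 : 0 < a by exact: lt_le_trans a1.
rewrite (Pf_stretch va a0) (max_idPl _)// exprSr mulfK ?gt_eqF//.
by rewrite powR_root// ltW.
Qed.

(** The norm is now 1, so [Kf] is the inverse of the slope, which is [t ^ m]. *)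
Lemma Pf_stretch_contract (v : R -> R) (x : V) (t : R) : is_derive (x 0 top) 1 v (t ^- m) -> 1 <= t ->
  Pf (stretch v) x = t%:E.
Proof.
move=> va t1; have t0 : 0 < t by exact: lt_le_trans t1.
rewrite (Pf_stretch va); last by rewrite invr_gt0 exprn_gt0.
rewrite (max_idPr _); last by rewrite invf_le1 ?exprn_gt0// exprn_ege1.
by rewrite expr1n invrK mul1r powR_root// ltW.
Qed.

End dilatation_of_stretch.

(** * Zigzag functions *)

Section zigzag.
Variables (R : realType) (l : R).
Hypothesis l01 : 0 < l < 1.

Definition frac (z : R) : R := z - (Num.floor z)%:~R.

Lemma frac_itv z : 0 <= frac z < 1.
Proof.
have := floor_itv z; rewrite intrD /frac => /andP[h1 h2]; apply/andP; split; lra.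
Qed.

(* The primitive of the 1-periodic function that is 1 on [0, l[ and 0 on [l, 1[. *)
Definition stair (z : R) : R := l * (Num.floor z)%:~R + Num.min (frac z) l.

Lemma stair_lipschitz y z : y <= z -> 0 <= stair z - stair y <= z - y.
Proof.
move=> yz; have [/andP[y0 y1] /andP[z0 z1]] := (frac_itv y, frac_itv z).
have /andP[l0 l1] := l01.
have hy : frac y = y - (Num.floor y)%:~R by [].
have hz : frac z = z - (Num.floor z)%:~R by [].
have := le_floor yz; rewrite le_eqVlt => /orP[/eqP e|].
  rewrite /stair -e; move: hz; rewrite -e.
  move: (Num.floor y)%:~R (frac y) (frac z) hy y0 y1 z0 z1 => k r s *.
  by have [?|?] := leP r l; have [?|?] := leP s l; apply/andP; split; lra.
rewrite -lezD1 -(ler_int R) intrD /stair.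
move: (Num.floor y)%:~R (Num.floor z)%:~R (frac y) (frac z) hy hz y0 y1 z0 z1.
move=> k k' r s *.
(* On each of the [k' - k - 1] whole periods between the two points, [stair] gains [l] and the
   argument gains 1; the two products give the lower and the upper bound. *)
have ? : 0 <= (k' - k - 1) * l by rewrite mulr_ge0; lra.
have ? : 0 <= (k' - k - 1) * (1 - l) by rewrite mulr_ge0; lra.
by have [?|?] := leP r l; have [?|?] := leP s l; apply/andP; split; nra.
Qed.

Lemma stair_near z : `|stair z - l * z| <= 1.
Proof.
have /andP[z0 z1] := frac_itv z; have /andP[l0 l1] := l01.
have hz : z = frac z + (Num.floor z)%:~R by rewrite /frac subrK.
rewrite /stair {3}hz mulrDr; move: (frac z) z0 z1 => s s0 s1.
have ? : 0 <= s * l by rewrite mulr_ge0// ltW.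
have ? : 0 <= (1 - s) * l by rewrite mulr_ge0; lra.
have ? : 0 <= s * (1 - l) by rewrite mulr_ge0; lra.
by rewrite ler_norml; have [?|?] := leP s l; apply/andP; split; lra.
Qed.

Variables (a b d : R).
Hypothesis d_gt0 : 0 < d.

(** The rescaled stair has period [d] and slope 1 on [steep], 0 elsewhere; it switches the slope
    from [b] to [a]. *)
Definition zigzag (y : R) : R := b * y + (a - b) * (d * stair (y / d)).

Definition steep : set R := [set y | frac (y / d) < l].

(** Besides being the derivative, this formula with two values of [Phi] in place of the slopes gives
    the density that bounds [Phi(P)]. *)
Definition zigzag' (y : R) : R := b + (a - b) * \1_steep y.

Definition kinks : set R :=
  [set d * (k.1%:~R + (if k.2 then l else 0)) | k in [set: int * bool]].

Lemma kinks_null : measurable kinks /\ lebesgue_measure kinks = 0%E.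
Proof.
have ck : countable kinks.
  by apply: (card_le_trans (card_image_le _ _)); exact: countableP.
split; last exact: countable_lebesgue_measure0.
by apply: countable_measurable => // t; exact: measurable_set1.
Qed.

Lemma steepE : steep = \bigcup_(k : int) `[d * k%:~R, d * (k%:~R + l)[%classic.
Proof.
have /andP[l0 l1] := l01.
apply/seteqP; split=> y; rewrite /steep /=.
- move=> h; exists (Num.floor (y / d)) => //=; rewrite in_itv /=.
  have /andP[h1 _] := floor_itv (y / d); move: h; rewrite /frac ltrBlDr.
  move: h1; rewrite ler_pdivlMr// ltr_pdivrMr// => h1 h2.
  by rewrite mulrC h1/= mulrC addrC.
- move=> [k _ /=]; rewrite in_itv /= => /andP[h1 h2].
  have e : Num.floor (y / d) = k.
    apply: floor_def; rewrite intrD ler_pdivlMr// mulrC h1 /= ltr_pdivrMr// mulrC.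
    by rewrite (lt_trans h2)// ltr_pM2l// ltrD2l.
  by rewrite /frac e ltrBlDr ltr_pdivrMr// mulrC addrC.
Qed.

Lemma steep_measurable : measurable steep.
Proof.
rewrite steepE; apply: countable_bigcupT_measurable; first exact: countableP.
by move=> k; exact: measurable_itv.
Qed.

(** [stair] never leaves the unit neighbourhood of its line of mean slope [l], and the scaling
    shrinks this distance to [d]. *)
Lemma zigzag_near y : `|zigzag y - (l * a + (1 - l) * b) * y| <= `|a - b| * d.
Proof.
have -> : zigzag y - (l * a + (1 - l) * b) * y =
    (a - b) * (d * (stair (y / d) - l * (y / d))).
  by rewrite /zigzag; field; rewrite gt_eqF.
rewrite normrM ler_wpM2l// normrM gtr0_norm// ler_piMr ?(ltW d_gt0)//.
exact: stair_near.
Qed.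

Lemma is_derive_affine (s t y : R) : is_derive y 1 (fun z => s * z + t) s.
Proof.
rewrite -[X in is_derive _ _ _ X]addr0 -[X in X + 0]mulr1.
apply: is_deriveD.
Qed.

Lemma zigzag_profile : 0 < a -> 0 < b ->
  profile zigzag zigzag' kinks (Num.min a b) (Num.max a b).
Proof.
move=> a0 b0; split.
- by rewrite lt_min a0.
- have mono y z : y <= z ->
    Num.min a b * (z - y) <= zigzag z - zigzag y <= Num.max a b * (z - y).
    move=> yz; have yz' : y / d <= z / d by rewrite ler_pM2r ?invr_gt0.
    have /andP[h1 h2] := stair_lipschitz yz'.
    rewrite (_ : zigzag z - zigzag y = b * (z - y) + (a - b) * (d * (stair (z / d) - stair (y / d)))); last first.
      by rewrite /zigzag; ring.
    (* [q] is the length of the steep part between [y] and [z], so the increment is a mixture of the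
       two slopes. *)
    set q := d * _.
    have q0 : 0 <= q by rewrite mulr_ge0// ltW.
    have q1 : q <= z - y.
      by move: h2; rewrite -mulrBl ler_pdivlMr// mulrC.
    by have [?|?] := leP a b; apply/andP; split; nra.
  have incr y z : y <= z -> 0 <= zigzag z - zigzag y.
    move=> yz; have /andP[h _] := mono _ _ yz; apply: le_trans h.
    by rewrite mulr_ge0 ?subr_ge0// le_min !ltW.
  move=> y z; have [yz|/ltW yz] := leP y z.
  + by rewrite distrC [X in _ <= X <= _]distrC !ger0_norm ?subr_ge0// ?mono//; have := incr _ _ yz; rewrite subr_ge0.
  + by rewrite !ger0_norm ?subr_ge0// ?mono//; have := incr _ _ yz; rewrite subr_ge0.
- apply: measurable_funD => //; apply: measurable_funM => //.
  exact: measurable_indic steep_measurable.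
- move=> y; rewrite /zigzag' indicE; case: (_ \in _).
    by rewrite mulr1 addrC subrK gtr0_norm// le_max lexx.
  by rewrite mulr0 addr0 gtr0_norm// le_max lexx orbT.
- exact: kinks_null.
move=> y yk.
pose k := Num.floor (y / d).
have yd : y = d * (y / d) by rewrite mulrC divfK ?gt_eqF.
have /andP[f0 f1] := frac_itv (y / d).
have f0' : 0 < frac (y / d).
  rewrite lt_neqAle f0 andbT; apply/negP => /eqP e; apply: yk; exists (k, false) => //=; rewrite addr0.
  by rewrite [RHS]yd; congr (d * _); apply/eqP; rewrite eq_sym -subr_eq0 -/(frac _) -e.
have fl : frac (y / d) != l.
  apply/negP => /eqP e; apply: yk; exists (k, true) => //=.
  by rewrite [RHS]yd; congr (d * _); rewrite -e /frac addrC subrK.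
(* Strictly inside a period the floor is constant, so [zigzag] is affine near [y] on either side of
   the kink [d * (k + l)]. *)
have floorE z : d * k%:~R < z < d * (k%:~R + 1) -> Num.floor (z / d) = k.
  move=> /andP[h1 h2]; apply: floor_def.
  by rewrite intrD ler_pdivlMr// ltr_pdivrMr// ![_ * d]mulrC h2 ltW.
have fracE z : d * k%:~R < z < d * (k%:~R + 1) -> frac (z / d) = z / d - k%:~R.
  by move=> /floorE; rewrite /frac => ->.
have /andP[l0 l1] := l01.
move: f0' f1 fl; rewrite /frac -/k => f0' f1; rewrite neq_lt => /orP[fl|fl].
- have -> : zigzag' y = a.
    by rewrite /zigzag' indicE mem_set ?mulr1 1?addrC ?subrK.
  apply: (@near_eq_is_derive _ _ _ (fun z => a * z + (a - b) * (d * (l * k%:~R - k%:~R)))); last exact: is_derive_affine.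
  have yI : y \in `]d * k%:~R, d * (k%:~R + l)[.
    by rewrite in_itv /= yd !ltr_pM2l//; apply/andP; split; lra.
  near=> z.
  have : z \in `]d * k%:~R, d * (k%:~R + l)[ by near: z; exact: near_in_itvoo.
  rewrite in_itv /= => /andP[z1 z2].
  have zI : d * k%:~R < z < d * (k%:~R + 1).
    by rewrite z1 (lt_trans z2)// ltr_pM2l// ltrD2l.
  rewrite /zigzag /stair (floorE _ zI) (fracE _ zI) (min_idPl _).
    by field; rewrite gt_eqF.
  by rewrite lerBlDr ler_pdivrMr// mulrC ltW// addrC.
- have -> : zigzag' y = b.
    by rewrite /zigzag' indicE memNset ?mulr0 ?addr0// /steep /= /frac -/k; apply/negP; rewrite -leNgt ltW.
  apply: (@near_eq_is_derive _ _ _ (fun z => b * z + (a - b) * (d * (l * k%:~R + l)))); last exact: is_derive_affine.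
  have yI : y \in `]d * (k%:~R + l), d * (k%:~R + 1)[.
    by rewrite in_itv /= yd !ltr_pM2l//; apply/andP; split; lra.
  near=> z.
  have : z \in `]d * (k%:~R + l), d * (k%:~R + 1)[ by near: z; exact: near_in_itvoo.
  rewrite in_itv /= => /andP[z1 z2].
  have zI : d * k%:~R < z < d * (k%:~R + 1).
    by rewrite z2 andbT (lt_trans _ z1)// ltr_pM2l// ltrDl.
  rewrite /zigzag /stair (floorE _ zI) (fracE _ zI) (min_idPr _)//.
  by rewrite lerBrDr ler_pdivlMr// mulrC ltW// addrC.
Unshelve. all: by end_near.
Qed.

End zigzag.

(** * Weak convergence of the zigzag slopes *)

Section weak_convergence.
Variables (R : realType) (l : R).
Hypothesis l01 : 0 < l < 1.
Local Notation leb := (@lebesgue_measure R).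

(** Compactness in its near-covering form. Only [x] is confined to the segment; halving the radius
    at each centre keeps both [x] and [y] in its neighbourhood. *)
Lemma uniformly_continuous_segment (g : R -> R) (N e : R) : continuous g -> 0 < e ->
  exists2 r, 0 < r & forall x y, `|x| <= N -> `|x - y| < r -> `|g x - g y| < e.
Proof.
move=> cg e0.
have /compact_near_coveringP/(_ R 0^'+ (fun r x => forall y, `|x - y| < r -> `|g x - g y| < e)) :=
  @segment_compact R (- N) N.
case.
  move=> x _; have e20 : 0 < e / 2 by rewrite divr_gt0.
  have /cvgrPdist_lt/(_ _ e20)/nbhs_ballP[r /= r0 rg] := cg x.
  exists (ball x (r / 2), [set s | s < r / 2]) => /=.
    split; first by apply: nbhsx_ballx; rewrite divr_gt0.
    by apply: nbhs_right_lt; rewrite divr_gt0.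
  move=> [z s] /= [xz sr] y zy.
  have h1 : `|g x - g z| < e / 2.
    by apply: rg; apply: le_ball xz; rewrite ler_pdivrMr// ler_peMr ?(ltW r0)// ler1n.
  have h2 : `|g x - g y| < e / 2.
    apply: rg; rewrite [r]splitr; apply: ball_triangle xz _.
    by apply: lt_trans zy _.
  rewrite [e]splitr -(subrKA (g x)) (le_lt_trans (ler_normD _ _))// ltrD// distrC//.
move=> r /= r0 rP; exists (r / 2); first by rewrite divr_gt0.
move=> x y xN xy; apply: (rP (r / 2)) => //=.
- by rewrite sub0r normrN gtr0_norm ?divr_gt0// gtr_pMr// invf_lt1// ltr1n.
- by rewrite divr_gt0.
- by rewrite in_itv /= -ler_norml.
Qed.

Variables (d : R).
Hypothesis d_gt0 : 0 < d.

(** The indicator of the steep part minus its mean, so that the integral over each period is 0. *)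
Definition osc (y : R) : R := \1_(steep l d) y - l.

Lemma osc_le1 y : `|osc y| <= 1.
Proof.
have /andP[l0 l1] := l01.
by rewrite /osc indicE; case: (_ \in _) => /=; rewrite ler_norml; apply/andP; split; lra.
Qed.

Lemma osc_measurable : measurable_fun setT osc.
Proof.
apply: measurable_funB => //; exact: (measurable_indic (steep_measurable l01 d_gt0)).
Qed.

Lemma osc_integrable (A : set (measurableTypeR R)) (f : R -> R) : measurable A ->
  leb.-integrable A (EFin \o f) -> leb.-integrable A (EFin \o (fun y => osc y * f y)).
Proof.
move=> mA /[dup] /integrableP[/measurable_EFinP mf _] intf.
apply: (@le_integrable _ _ _ leb A mA _ (EFin \o f)) => //.
  apply/measurable_EFinP; apply: measurable_funM => //.
  exact: measurable_funS osc_measurable.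
move=> y _ /=; rewrite lee_fin normrM ler_piMl//; exact: osc_le1.
Qed.

Lemma continuous_integrable_itv (g : R -> R) (x y : R) : continuous g ->
  leb.-integrable `[x, y[ (EFin \o g).
Proof.
move=> cg; apply: (@integrableS _ _ _ leb `[x, y]%classic `[x, y[%classic (EFin \o g)) => //.
  by apply: subset_itvl; rewrite bnd_simp.
by apply: continuous_compact_integrable; [exact: segment_compact|exact: continuous_subspaceT].
Qed.

(** As [osc] has integral 0 over the cell, [g] may be replaced by its deviation from its value at
    the left endpoint, which is at most [e]. *)
Lemma osc_cell (g : R -> R) (k : int) e : continuous g ->
  (forall y, d * k%:~R <= y < d * (k%:~R + 1) -> `|g (d * k%:~R) - g y| <= e) ->
  `|\int[leb]_(y in `[(d * k%:~R), (d * (k%:~R + 1))[) (osc y * g y)| <= e * d.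
Proof.
move=> cg ge; set c : set (measurableTypeR R) := `[(d * k%:~R), (d * (k%:~R + 1))[%classic.
have /andP[l0 l1] := l01.
have mc : measurable c by exact: measurable_itv.
have lc : leb c = d%:E.
  by rewrite lebesgue_measure_itv /= lte_fin ltr_pM2l// ltrDl ltr01 -EFinB -mulrBr addrAC subrr add0r mulr1.
have lcoo : (leb c < +oo)%E by rewrite lc ltry.
have cst_c r : \int[leb]_(_ in c) r = r * d.
  by rewrite Rintegral_cst//; congr (_ * _); exact: (congr1 fine lc).
have icst r : leb.-integrable c (EFin \o cst r).
  by apply: measurable_bounded_integrable => //; exact: bounded_cst.
have icg : leb.-integrable c (EFin \o g) by exact: continuous_integrable_itv.
have sc : steep l d `&` c = `[d * k%:~R, d * (k%:~R + l)[%classic.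
  rewrite steepE//; apply/seteqP; split=> y.
    move=> [[k' _ /=]]; rewrite /c /= !in_itv /= => /andP[h1 h2] /andP[h3 h4].
    suff -> : k = k' by rewrite h1.
    have : d * k'%:~R < d * (k%:~R + 1) by exact: le_lt_trans h4.
    have : d * k%:~R < d * (k'%:~R + 1).
      by apply: (le_lt_trans h3); apply: (lt_trans h2); rewrite ltr_pM2l// ltrD2l.
    rewrite !ltr_pM2l// -[1]/(1%:~R) -!intrD !ltr_int !ltzD1 => h5 h6.
    by apply/eqP; rewrite eq_le h5.
  move=> h; split; first by exists k.
  move: h; rewrite /c /= !in_itv /= => /andP[-> h] /=.
  by rewrite (lt_trans h)// ltr_pM2l// ltrD2l.
have osc0 : \int[leb]_(y in c) osc y = 0.
  have ii : leb.-integrable c (EFin \o \1_(steep l d)).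
    apply: measurable_bounded_integrable => //.
      exact: (measurable_indic (steep_measurable l01 d_gt0)).
    exists 1; split => // M M1 y _ /=; rewrite indicE.
    by case: (_ \in _); rewrite ?normr1 ?normr0 ltW// (lt_trans _ M1).
  rewrite (RintegralB mc ii (icst l)).
  rewrite cst_c /Rintegral integral_indic//; last exact: steep_measurable.
  have es : lebesgue_measure (steep l d `&` c) = (l * d)%:E.
    rewrite sc lebesgue_measure_itv /= lte_fin ltr_pM2l// ltrDl l0 -EFinB.
    by rewrite -mulrBr addrAC subrr add0r mulrC.
  by transitivity (l * d - l * d); [congr (_ - _); exact: (congr1 fine es)|rewrite subrr].
have -> : \int[leb]_(y in c) (osc y * g y) =
    \int[leb]_(y in c) (osc y * (g y - g (d * k%:~R))).
  under [RHS]eq_Rintegral do rewrite mulrBr.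
  rewrite (RintegralB mc (osc_integrable mc icg) (osc_integrable mc (icst (g (d * k%:~R))))).
  have iosc : leb.-integrable c (EFin \o osc).
    have := osc_integrable mc (icst 1); apply: eq_integrable => // y _.
    by rewrite /= mulr1.
  by rewrite (RintegralZr _ mc iosc) osc0 mul0r subr0.
have ig : leb.-integrable c (EFin \o (fun y => g y - g (d * k%:~R))).
  exact: (integrableB mc icg (icst _)).
apply: (le_trans (le_normr_Rintegral _ _)) => //; first exact: osc_integrable.
apply: (@le_trans _ _ (\int[leb]_(y in c) e)); last by rewrite cst_c.
apply: (le_Rintegral mc (integrable_norm (osc_integrable mc ig)) (icst e)).
move=> y; rewrite /c /= in_itv /= => yc.
rewrite normrM -[e]mul1r ler_pM//; first exact: osc_le1.
by rewrite distrC; exact: ge.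
Qed.

Lemma osc_cells (g : R -> R) (k0 : int) (p : nat) e : continuous g ->
  (forall x y, d * k0%:~R <= x <= d * (k0%:~R + p%:R) -> `|x - y| < d -> `|g x - g y| <= e) ->
  `|\int[leb]_(y in `[(d * k0%:~R), (d * (k0%:~R + p%:R))[) (osc y * g y)| <= e * d * p%:R.
Proof.
move=> cg; elim: p => [|p IH] ge.
  by rewrite addr0 set_itvco0 Rintegral_set0 normr0 mulr0.
have d0 : 0 <= d by exact: ltW.
have e1 : d * (k0%:~R + p%:R) = d * (k0 + p)%:~R by rewrite intrD.
have e2 : d * (k0%:~R + p.+1%:R) = d * ((k0 + p)%:~R + 1) by rewrite intrD -addrA natr1.
have mono : d * k0%:~R <= d * (k0 + p)%:~R by rewrite ler_pM2l// intrD lerDl.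
have mono' : d * (k0 + p)%:~R <= d * ((k0 + p)%:~R + 1) by rewrite ler_pM2l// lerDl.
have split : `[d * k0%:~R, d * ((k0 + p)%:~R + 1)[%classic =
    `[d * k0%:~R, d * (k0 + p)%:~R[ `|` `[d * (k0 + p)%:~R, d * ((k0 + p)%:~R + 1)[.
  by apply: itv_bndbnd_setU; rewrite bnd_simp.
rewrite e2 split Rintegral_setU//; last 2 first.
- by rewrite -split; apply: osc_integrable => //; exact: continuous_integrable_itv.
- apply/disj_setPLR => y /=; rewrite !in_itv /= => /andP[_ h1] /andP[h2 _].
  by move: h1; rewrite ltNge h2.
apply: (le_trans (ler_normD _ _)); rewrite -[p.+1%:R]natr1 [leRHS]mulrDr [X in _ <= _ + X]mulr1 lerD//.
- rewrite -e1; apply: IH => x y /andP[h1 h2]; apply: ge; rewrite h1 e2 /=.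
  by rewrite (le_trans h2)// e1.
- apply: osc_cell => // y /andP[h1 h2]; apply: ge.
    by rewrite mono e2.
  rewrite distrC ger0_norm ?subr_ge0// ltrBlDr (lt_le_trans h2)//.
  by rewrite mulrDr mulr1 addrC.
Qed.

End weak_convergence.

Section steep_weak_convergence.
Variables (R : realType) (l : R).
Hypothesis l01 : 0 < l < 1.
Local Notation leb := (@lebesgue_measure R).

(** A Riemann-Lebesgue argument: since [osc] is bounded by 1, [h] may be replaced by a continuous
    function close to it in L1, and for that one each small cell contributes little. *)
Lemma steep_weak_cvg (h : R -> R) (N : nat) :
  leb.-integrable `[- N%:R, N%:R[ (EFin \o h) ->
  \int[leb]_(y in `[(- N%:R), N%:R[) (osc l j.+1%:R^-1 y * h y) @[j --> \oo] --> 0.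
Proof.
move=> ih; set E : set (measurableTypeR R) := `[- N%:R, N%:R[%classic.
have mE : measurable E by exact: measurable_itv.
have Eoo : (leb E < +oo)%E.
  by rewrite lebesgue_measure_itv /=; case: ifP; rewrite ?ltry// -EFinB ltry.
have [g_ [cg ig gh]] := approximation_continuous_integrable mE Eoo ih.
apply/cvgrPdist_le => e e0.
(* Approximation in L1 costs [e'], and the cells, of total length [2 * N], cost [e' * (2 * N)]. *)
pose e' := e / (2 * N%:R + 1).
have N0 : 0 < 2 * N%:R + 1 :> R by rewrite ltr_wpDl// mulr_ge0.
have e'0 : 0 < e' by rewrite divr_gt0.
have [n hn] : exists n, (\int[leb]_(z in E) `|(h z - g_ n z)%:E| < e'%:E)%E.
  have /fine_cvgP[gfin /cvgrPdist_lt/(_ _ e'0) glt] := gh.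
  have [n [n1 n2]] := filter_ex (filterI gfin glt); exists n.
  rewrite -(fineK n1) lte_fin; apply: le_lt_trans n2.
  by rewrite sub0r normrN ler_norm.
have [r r0 gr] := uniformly_continuous_segment N%:R (cg n) e'0.
have r0' : 0 <= r^-1 by rewrite invr_ge0 ltW.
exists (Num.bound r^-1) => // j /= jr.
rewrite sub0r normrN.
set d : R := j.+1%:R^-1.
have d0 : 0 < d by rewrite invr_gt0.
have dr : d < r.
  rewrite invf_plt ?posrE//; apply: (lt_le_trans (archi_boundP r0')).
  by rewrite ler_nat (leq_trans jr).
have ihg : leb.-integrable E (EFin \o (fun y => h y - g_ n y)).
  exact: (integrableB mE ih (ig n)).
have -> : \int[leb]_(y in E) (osc l d y * h y) =
    \int[leb]_(y in E) (osc l d y * (h y - g_ n y)) +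
    \int[leb]_(y in E) (osc l d y * g_ n y).
  rewrite -RintegralD//; [|exact: osc_integrable|exact: osc_integrable].
  by apply: eq_Rintegral => y _; rewrite -mulrDr subrK.
have -> : e = e' + e' * (2 * N%:R).
  by rewrite -[X in X + _]mulr1 -mulrDr addrC divfK// gt_eqF.
apply: (le_trans (ler_normD _ _)); apply: lerD.
  rewrite -lee_fin; apply: le_trans (ltW hn).
  rewrite EFin_normr_Rintegral//; last exact: osc_integrable.
  apply: (le_trans (le_abse_integral _ mE _)).
    by have /integrableP[] := osc_integrable l01 d0 mE ihg.
  apply: ge0_le_integral => //.
  - apply: measurableT_comp => //.
    by have /integrableP[] := osc_integrable l01 d0 mE ihg.
  - apply: measurableT_comp => //.
    by have /integrableP[] := ihg.
  - by move=> y _ /=; rewrite lee_fin normrM ler_piMl//; exact: osc_le1.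
(* Because [N] is a natural number and [d = 1/(j+1)], the interval consists of exactly
   [2 * N * (j+1)] whole periods. *)
have eL : - N%:R = d * (- (N * j.+1)%N%:Z)%:~R.
  by rewrite /d mulrNz mulrN -pmulrn natrM mulrCA mulVf ?mulr1.
have eR : N%:R = d * ((- (N * j.+1)%N%:Z)%:~R + (2 * N * j.+1)%N%:R).
  rewrite mulrDr -eL /d !natrM mulrCA mulVf// mulr1 mulrDl mul1r addKr//.
have h3 := @osc_cells R l l01 d d0 (g_ n) (- (N * j.+1)%N%:Z) (2 * N * j.+1)%N e' (cg n).
rewrite /E eL [X in Interval _ (BLeft X)]eR.
apply: le_trans (h3 _) _.
  move=> x y; rewrite -eL -eR => xN xy; apply: ltW; apply: gr.
    by rewrite ler_norml.
  exact: lt_trans dr.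
rewrite -mulrA ler_wpM2l ?(ltW e'0)//.
by rewrite /d !natrM mulrCA mulVf// mulr1.
Qed.

End steep_weak_convergence.

(** * Upper bounds for integrals *)

Section integral_upper_bound.
Local Open Scope ereal_scope.
Context d (T : measurableType d) (R : realType).
Variable mu : {measure set T -> \bar R}.

(* [F] need not be measurable nor nonnegative: nothing is known about
   [Phi (Pf f x)] at the kinks of [f]. *)
Lemma le_integral_ge0_bound (D : set T) (F G : T -> \bar R) :
  (forall x, D x -> F x <= G x) -> (forall x, D x -> 0 <= G x) ->
  \int[mu]_(x in D) F x <= \int[mu]_(x in D) G x.
Proof.
move=> FG G0; rewrite integralE.
apply: (@le_trans _ _ (\int[mu]_(x in D) F^\+ x)).
  by rewrite -[leRHS]sube0; apply: leeB => //; apply: integral_ge0.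
(* The integral of a nonnegative function is a supremum over the simple functions below it, and
   those below [F^\+] are below [G]. *)
rewrite !ge0_integralE//; apply: ereal_sup_le => _ [h hF <-]; exists h => //.
move=> x; apply: (le_trans (hF x)); rewrite !patchE; case: ifPn => //.
by rewrite inE => Dx; rewrite funeposE ge_max FG// G0.
Qed.

(** The majorant is raised to [+oo] on [N], where it then dominates any [F]; being measurable and
    almost everywhere equal to [G], it has the same integral. *)
Lemma le_integral_ae_bound (D N : set T) (F G : T -> \bar R) :
  measurable D -> measurable N -> mu N = 0 -> measurable_fun D G ->
  (forall x, D x -> ~ N x -> F x <= G x) -> (forall x, D x -> 0 <= G x) ->
  \int[mu]_(x in D) F x <= \int[mu]_(x in D) G x.
Proof.
move=> mD mN N0 mG FG G0.
pose G' x := if x \in N then +oo else G x.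
have mG' : measurable_fun D G'.
  apply: measurable_fun_if => //.
  - apply: (@measurable_funS _ _ _ _ setT) => //.
    apply: (measurable_fun_bool true); rewrite setTI.
    rewrite [X in measurable X](_ : _ = N)//.
    by apply/seteqP; split=> x /=; [exact: set_mem|exact: mem_set].
  - exact: measurable_funS mG.
have G'0 x : D x -> 0 <= G' x by move=> Dx; rewrite /G'; case: ifP => // _; exact: G0.
apply: (@le_trans _ _ (\int[mu]_(x in D) G' x)).
  apply: le_integral_ge0_bound => // x Dx; rewrite /G'; case: ifPn => [_|xN].
    exact: leey.
  by apply: FG => //; rewrite -notin_setE.
rewrite (@ge0_ae_eq_integral _ _ _ mu D G' G)//.
exists N; split=> // x; apply: contra_notP => xN Dx.
by rewrite /G' memNset.
Qed.

End integral_upper_bound.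

Lemma le_limn_esup (R : realType) (u v : (\bar R)^nat) :
  (forall j, u j <= v j)%E -> (limn_esup u <= limn_esup v)%E.
Proof.
move=> uv; rewrite !limn_esup_lim; apply: lee_lim; [exact: is_cvg_esups..|].
apply: nearW => j; rewrite /esups /=; apply: ge_ereal_sup => _ [k /= jk <-].
by apply: (le_trans (uv k)); apply: ereal_sup_ubound; exists k.
Qed.

(** * Marginals along the last coordinate *)

Section last_coordinate_integral.
Variables (R : realType) (m : nat).
Local Notation V := 'rV[R]_m.+1.
Local Notation tup := (@tup2rv R m.+1).
Local Notation mu := (lebn R m.+1).
Local Notation leb := (@lebesgue_measure R).

(** [h] is the integral of [F] over the slice at height [y], finite because [F] is bounded with
    bounded support. It is chosen before [rho], so one weight serves all densities of a sequence. *)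
Lemma last_marginal (F : V -> R) (C N : R) :
  measurable_fun setT (F \o tup) -> (forall x, 0 <= F x <= C) ->
  (forall x, N < `|x| -> F x = 0) ->
  exists (h : R -> R) (M : nat), [/\ forall y, 0 <= h y,
    leb.-integrable `[- M%:R, M%:R[ (EFin \o h) &
    forall rho : R -> R, measurable_fun setT rho -> (forall y, 0 <= rho y) ->
      (\int[mu]_p (rho p.2 * F (tup p))%:E =
       \int[leb]_(y in `[(- M%:R)%R, M%:R%R[) (rho y * h y)%:E)%E].
Proof.
move=> mF F0 FN.
have F0' x : 0 <= F x by case/andP: (F0 x).
have iF : mu.-integrable setT (fun p => (F (tup p))%:E).
  apply: (@bounded_support_integrable _ _ F C N) => // x.
  by case/andP: (F0 x) => *; rewrite ger0_norm.
have mFE : measurable_fun setT (fun p => (F (tup p))%:E) by exact/measurable_EFinP.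
pose H y := (\int[lebn R m]_q (F (tup ((q, y) : projT2 (Mn R m.+1))))%:E)%E.
have mH : measurable_fun [set: measurableTypeR R] H.
  by apply: (measurable_lebn_slice2 mFE) => p; rewrite lee_fin.
have H0 y : (0 <= H y)%E by apply: integral_ge0 => q _; rewrite lee_fin.
pose M := Num.bound `|N|.
have NM : N < M%:R by rewrite (le_lt_trans (ler_norm N))// archi_boundP.
have M0 : 0 <= M%:R :> R by [].
pose E : set (measurableTypeR R) := `[- M%:R, M%:R[%classic.
have mE : measurable E by exact: measurable_itv.
have FE q y : ~ E y -> F (tup ((q, y) : projT2 (Mn R m.+1))) = 0.
  move=> Ey; apply: FN.
  have := coord_le_norm (tup ((q, y) : projT2 (Mn R m.+1))) ord_max.
  rewrite last_coord /= => /(lt_le_trans _); apply.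
  apply: (lt_le_trans NM); rewrite leNgt; apply/negP => yM; apply: Ey.
  by rewrite /E /= in_itv /=; move: yM; rewrite ltr_norml => /andP[/ltW -> ->].
have mFy y : measurable_fun setT (fun q => (F (tup ((q, y) : projT2 (Mn R m.+1))))%:E).
  exact: (measurableT_comp mFE (measurable_pair2 y)).
have Hfin y : (H y < +oo)%E.
  pose A := @lrect R m (fun=> - (`|N| + 1)) (fun=> `|N| + 1).
  have mA : measurable A by exact: lrect_measurable.
  have /andP[_ Aoo] : (0 < lebn R m A < +oo)%E.
    apply: lebn_lrect => _; exact: gtrN (ltr_wpDl (normr_ge0 N) ltr01).
  have -> : H y = (\int[lebn R m]_(q in A) (F (tup ((q, y) : projT2 (Mn R m.+1))))%:E)%E.
    rewrite [RHS]integral_mkcond; apply: eq_integral => q _.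
    rewrite patchE; case: ifPn => //; rewrite notin_setE => qA; congr EFin.
    apply: FN; rewrite ltNge; apply/negP => le; apply: qA => k km.
    rewrite -ler_norml.
    have := coord_le_norm (tup ((q, y) : projT2 (Mn R m.+1))) (Ordinal (ltnW km : (k < m.+1)%N)).
    rewrite tup2rvE coordS /= (ltn_eqF km) => /le_trans; apply.
    by rewrite (le_trans le)// (le_trans (ler_norm _))// lerDl.
  apply: (@le_lt_trans _ _ (\int[lebn R m]_(q in A) C%:E)%E).
    apply: le_integral_ge0_bound => q _; rewrite lee_fin.
      by case/andP: (F0 (tup ((q, y) : projT2 (Mn R m.+1)))).
    by case/andP: (F0 0) => /le_trans h /h.
  rewrite integral_cst// lte_mul_pinfty//.
  by rewrite lee_fin; case/andP: (F0 0) => /le_trans h /h.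
pose h y := fine (H y).
have hE y : (h y)%:E = H y by rewrite /h fineK// ge0_fin_numE.
have fub (rho : R -> R) : measurable_fun setT rho -> (forall y, 0 <= rho y) ->
    (\int[mu]_p (rho p.2 * F (tup p))%:E = \int[leb]_(y in E) (rho y * h y)%:E)%E.
  move=> mrho rho0.
  have m2 : measurable_fun setT (fun p : projT2 (Mn R m) * measurableTypeR R => p.2 : measurableTypeR R).
    exact: measurable_snd.
  rewrite (@lebn_fubini2 _ _ (fun p : projT2 (Mn R m.+1) => (rho p.2 * F (tup p))%:E)); last 2 first.
  - apply/measurable_EFinP.
    exact: (measurable_funM (measurableT_comp mrho m2) mF).
  - by move=> p; rewrite lee_fin mulr_ge0.
  rewrite [RHS]integral_mkcond; apply: eq_integral => y _.
  rewrite patchE /=; case: ifPn => yE.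
    rewrite EFinM hE /H -ge0_integralZl//.
    - by move=> q _; rewrite lee_fin.
    - by rewrite lee_fin.
  apply: integral0_eq => q _.
  by rewrite FE ?mulr0//; move: yE; rewrite notin_setE.
exists h, M; split=> //; first by move=> y; exact: fine_ge0.
have hH : EFin \o h = H by apply/funext => y; exact: hE.
apply/integrableP; split; first by rewrite hH; exact: measurable_funTS.
(* Integrability of [h] is the Fubini formula with [rho = 1]. *)
rewrite (_ : (\int[_]_(x in _) _)%E = (\int[mu]_p (F (tup p))%:E)%E).
  have /integrableP[_] := iF; apply: le_lt_trans; apply: le_integral_ge0_bound => //.
  by move=> p _; rewrite abse_EFin lee_fin ler_norm.
transitivity (\int[leb]_(y in E) (1 * h y)%:E)%E.
  by apply: eq_integral => y _; rewrite /= mul1r ger0_norm// fine_ge0.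
rewrite -(fub (cst 1))//; by apply: eq_integral => p _; rewrite mul1r.
Qed.

End last_coordinate_integral.

(** * Limits of stretches *)

Section limsup_of_stretches.
Variables (R : realType) (m : nat).
Local Notation V := 'rV[R]_m.+1.
Local Notation tup := (@tup2rv R m.+1).
Local Notation mu := (lebn R m.+1).
Local Notation leb := (@lebesgue_measure R).
Local Notation top := (@ord_max m).

(** A zero integral would force [Psi] to vanish almost everywhere on [Omega], a set of positive
    measure. *)
Lemma intRn_open_gt0 (Omega : set V) (Psi : V -> R) :
  open Omega -> Omega !=set0 -> continuous Psi -> (forall x, 0 < Psi x) ->
  (0 < intRn Omega (fun x => (Psi x)%:E))%E.
Proof.
move=> oO O0 cPsi Psi0; rewrite lt0e integral_ge0 ?andbT; last first.
  by move=> p _; rewrite lee_fin ltW.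
apply/eqP => I0.
have mO := open_preimage_measurable oO.
have mP : measurable_fun (tup @^-1` Omega) (fun p => (Psi (tup p))%:E).
  by apply/measurable_EFinP; apply: measurable_funTS; exact: continuous_tup2rv_measurable.
have /(ae_eq_integral_abs mu mO mP) [A [mA A0 sub]] :
    (\int[mu]_(p in tup @^-1` Omega) `|(Psi (tup p))%:E| = 0)%E.
  rewrite -[RHS]I0; apply: eq_integral => p _.
  by rewrite abse_EFin gtr0_norm.
have := lebn_open_gt0 oO O0; rewrite lt0e => /andP[/negP + _]; apply.
rewrite -measure_le0 -A0; apply: le_measure; rewrite ?inE// => p Op.
by apply: sub => /(_ Op)[] e; have := Psi0 (tup p); rewrite e ltxx.
Qed.

Lemma marginal_of_weight (Omega : set V) (Psi : V -> R) :
  open Omega -> bounded_set Omega -> continuous Psi -> (forall x, 0 < Psi x) ->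
  exists (h : R -> R) (M : nat), [/\ forall y, 0 <= h y,
    leb.-integrable `[- M%:R, M%:R[ (EFin \o h) &
    forall rho : R -> R, measurable_fun setT rho -> (forall y, 0 <= rho y) ->
      (intRn Omega (fun x => (rho (x 0 top) * Psi x)%:E) =
       \int[leb]_(y in `[(- M%:R)%R, M%:R%R[) (rho y * h y)%:E)%E].
Proof.
move=> oO [K [_ bO]] cPsi Psi0.
have ON x : Omega x -> `|x| <= `|K| + 1.
  by apply: bO; rewrite (le_lt_trans (ler_norm _))// ltrDl.
have [C PsiC] := continuous_bounded_cube cPsi (`|K| + 1).
pose F x := Psi x * \1_Omega x.
have mO := open_preimage_measurable oO.
have mF : measurable_fun setT (F \o tup).
  apply: (@measurable_funM _ _ _ _ (Psi \o tup) (\1_(tup @^-1` Omega))).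
    exact: continuous_tup2rv_measurable.
  exact: (measurable_indic mO).
have Fout x : ~ Omega x -> F x = 0 by move=> Ox; rewrite /F indicE memNset// mulr0.
have Fin x : Omega x -> F x = Psi x by move=> Ox; rewrite /F indicE mem_set// mulr1.
have [||h [M [h0 ih hF]]] := @last_marginal R m F (Num.max C 0) (`|K| + 1) mF.
- move=> x; have [Ox|Ox] := pselect (Omega x).
    rewrite Fin// ltW//= le_max (le_trans (ler_norm _))//.
    exact: PsiC (ON _ Ox).
  by rewrite Fout// lexx le_max lexx orbT.
- by move=> x Kx; apply: Fout => /ON; rewrite leNgt Kx.
exists h, M; split=> // rho mrho rho0; rewrite -hF// /intRn integral_mkcond.
apply: eq_integral => p _; rewrite patchE; case: ifPn.
  by rewrite inE /= last_coord => /Fin ->.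
by rewrite notin_setE /= => /Fout ->; rewrite mulr0.
Qed.

Variables (D : set V) (Phi : \bar R -> \bar R).
Variables (v_ dv_ : nat -> R -> R) (Z_ : nat -> set R) (c_ C_ : nat -> R).
Variables (a : R) (rho_ : nat -> R -> R) (L B : R) (P : \bar R).
(** Common frame for the linear and the zigzag families: [rho_ j] is a bounded density in the last
    coordinate, dominating [Phi(P)] of the [j]-th map off its kinks and converging weakly to the
    constant [L]; [P] is the constant value along the limit map. *)
Hypothesis pv : forall j, profile (v_ j) (dv_ j) (Z_ j) (c_ j) (C_ j).
Hypothesis vcvg : forall M eps : R, 0 < eps ->
  \forall j \near \oo, forall y, `|y| <= M -> `|v_ j y - a * y| < eps.
Hypothesis mrho : forall j, measurable_fun setT (rho_ j).
Hypothesis rhoB : forall j y, 0 <= rho_ j y <= B.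
Hypothesis Phi_rho : forall j (x : V), ~ Z_ j (x 0 top) ->
  (Phi (Pf (stretch (v_ j)) x) <= (rho_ j (x 0 top))%:E)%E.
Hypothesis rho_cvg : forall (h : R -> R) (M : nat),
  leb.-integrable `[- M%:R, M%:R[ (EFin \o h) ->
  \int[leb]_(y in `[(- M%:R), M%:R[) (rho_ j y * h y) @[j --> \oo] -->
  L * \int[leb]_(y in `[(- M%:R), M%:R[) h y.
Hypothesis L0 : 0 <= L.
Hypothesis Pa : forall x : V, Pf (stretch (fun y => a * y)) x = P.
Hypothesis LP : (L%:E < Phi P)%E.

(** With [I] the integral of [Psi] over [Omega], the upper limit is at most the limit [L * I] of the
    integrals of the densities, and the limit map gives exactly [Phi P * I]. Strictness survives the
    product because [I] is positive and finite. *)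
Lemma limsup_stretch_lt (Omega : set V) (Psi : V -> R) :
  open Omega -> bounded_set Omega -> Omega !=set0 ->
  continuous Psi -> (forall x, 0 < Psi x) ->
  (limn_esup (fun j => intRn Omega
      (fun x => Phi (Pf (stretch (v_ j)) x) * (Psi x)%:E)%E)
   < intRn Omega (fun x => Phi (Pf (stretch (fun y => a * y)%R) x) * (Psi x)%:E)%E)%E.
Proof.
move=> oO bO O0 cPsi Psi0.
have [h [M [h0 ih hint]]] := marginal_of_weight oO bO cPsi Psi0.
set E : set (measurableTypeR R) := `[- M%:R, M%:R[%classic in ih hint.
have mE : measurable E by exact: measurable_itv.
have mO := open_preimage_measurable oO.
have mP : measurable_fun setT (Psi \o tup) by exact: continuous_tup2rv_measurable.
have mlast : measurable_fun setT (fun p => tup p 0 top).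
  rewrite (_ : (fun p => _) = fun p => coord p m); first exact: coord_measurable.
  by apply/funext => p; rewrite tup2rvE.
set I := intRn Omega (fun x => (Psi x)%:E).
have I0 : (0 < I)%E by exact: intRn_open_gt0.
have IE : I = (\int[leb]_(y in E) h y)%:E.
  rewrite /Rintegral fineK; last exact: integrable_fin_num.
  transitivity (\int[leb]_(y in E) (1 * h y)%:E)%E.
    rewrite -(hint (cst 1))//; by apply: eq_integral => p _; rewrite mul1r.
  by apply: eq_integral => y _; rewrite mul1r.
have limE : intRn Omega (fun x => Phi (Pf (stretch (fun y => a * y)%R) x) * (Psi x)%:E)%E =
    (Phi P * I)%E.
  rewrite /I /intRn -ge0_integralZl//.
  - by apply: eq_integral => p _; rewrite Pa.
  - by apply/measurable_EFinP; exact: measurable_funTS.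
  - by move=> p _; rewrite lee_fin ltW.
  - by apply: le_trans (ltW LP); rewrite lee_fin.
rewrite [ltRHS]limE; apply: (@le_lt_trans _ _ (L%:E * I)%E); last first.
  by rewrite lte_pmul2r// IE.
have irho j : leb.-integrable E (EFin \o (fun y => rho_ j y * h y)).
  have iBh : leb.-integrable E (EFin \o (fun y => B * h y)).
    exact: (integrableZl mE B ih).
  apply: (@le_integrable _ _ _ leb E mE _ (EFin \o (fun y => B * h y))) => //.
    have /integrableP[/measurable_EFinP mh _] := ih.
    apply/measurable_EFinP; apply: measurable_funM; last exact: mh.
    exact: (measurable_funTS (mrho j)).
  move=> y _ /=; have /andP[r0 rB] := rhoB j y.
  by rewrite lee_fin !normrM ler_wpM2r// !ger0_norm// (le_trans r0).
apply: (@le_trans _ _ (limn_esup (fun j => (\int[leb]_(y in E) (rho_ j y * h y))%:E))).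
  apply: le_limn_esup => j.
  have [mZ Z0] := profile_null (pv j).
  have [mZ' Z'0] := last_coord_null m mZ Z0.
  apply: (@le_trans _ _ (intRn Omega (fun x => (rho_ j (x 0 top) * Psi x)%:E))).
    apply: (@le_integral_ae_bound _ _ _ mu _ (tup @^-1` [set x | Z_ j (x 0 top)])) => //.
    - apply/measurable_EFinP; apply: measurable_funTS; apply: measurable_funM => //.
      exact: measurableT_comp.
    - move=> p _ nZ; rewrite EFinM; apply: lee_wpmul2r; first by rewrite lee_fin ltW.
      exact: Phi_rho.
    - move=> p _; rewrite lee_fin mulr_ge0 ?(ltW (Psi0 _))//.
      by case/andP: (rhoB j (tup p 0 top)).
  rewrite hint//; last by move=> y; case/andP: (rhoB j y).
  by rewrite /Rintegral fineK//; exact: (integrable_fin_num mE (irho j)).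
have lim : (\int[leb]_(y in E) (rho_ j y * h y))%:E @[j --> \oo] -->
    (L * \int[leb]_(y in E) h y)%:E.
  by apply: cvg_EFin; [exact: nearW|exact: rho_cvg].
by rewrite (cvg_limn_einf_sup lim).2 IE -EFinM.
Qed.

Lemma stretch_loc_unif_cvg :
  loc_unif_cvg D (fun j => stretch (v_ j)) (stretch (fun y => a * y)).
Proof.
move=> K cK _ eps eps0; have [N hN] := compact_norm_bound cK.
have := vcvg N%:R eps0; apply: filterS => j hj x Kx.
have -> : eucl (stretch (v_ j) x - stretch (fun y => a * y) x) =
    `|v_ j (x 0 top) - a * x 0 top|.
  rewrite /eucl big_ord1 (bigD1 top)//= big1 => [|i iT].
    by rewrite addr0 !mxE eqxx sqrtr_sqr.
  by rewrite !mxE (negbTE iT) subrr expr0n.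
by apply: hj; apply: (le_trans (coord_le_norm _ _)); exact: hN.
Qed.

(** Continuity is shown directly, without a [profile], since the slope [a = 0] of a projection must
    be covered. *)
Lemma stretch_linear_differentiable (x : V) : differentiable (stretch (fun y => a * y)) x.
Proof.
have e : stretch (fun y => a * y) = mulmxr (diag_mx (stretch_diag m a)) :> (V -> V).
  apply/funext => y; apply/rowP => i; rewrite /= mul_mx_diag !mxE.
  by case: ifP => _; [rewrite mulrC|rewrite mulr1].
have cs : continuous (stretch (fun y => a * y) : V -> V).
  pose K := Num.max `|a| 1.
  have K0 : 0 < K by rewrite lt_max ltr01 orbT.
  move=> y; apply/(@cvgrPdist_lt _ _ _ (nbhs y) _ (stretch (fun z => a * z))) => eps eps0.
  apply/nbhs_ballP; exists (eps / K) => /=; first by rewrite divr_gt0.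
  move=> z; rewrite -ball_normE /= ltr_pdivlMr// mulrC; apply: le_lt_trans.
  apply: norm_le_coord => [|i]; first by rewrite mulr_ge0// ltW.
  apply: (@le_trans _ _ (K * `|y 0 i - z 0 i|)); last first.
    by rewrite ler_wpM2l ?(ltW K0)//; have := coord_le_norm (y - z) i; rewrite !mxE.
  rewrite !mxE; case: ifP => _; last by rewrite ler_peMl// le_max lexx orbT.
  by rewrite -mulrBr normrM ler_wpM2r// le_max lexx.
rewrite e in cs *.
exact: (linear_differentiable x cs).
Qed.

Lemma stretch_counterexample :
  exists (fs : nat -> V -> V) (f : V -> V),
    [/\ forall j, homeo_into D (fs j) /\ W11loc D (fs j),
        loc_unif_cvg D fs f,
        ae_differentiable D f &
        forall (Omega : set V) (Psi : V -> R),
          open Omega -> bounded_set Omega -> Omega !=set0 -> Omega `<=` D ->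
          continuous Psi -> (forall x, 0 < Psi x) ->
          (limn_esup (fun j => intRn Omega
              (fun x => Phi (Pf (fs j) x) * (Psi x)%:E)%E)
           < intRn Omega (fun x => Phi (Pf f x) * (Psi x)%:E)%E)%E].
Proof.
exists (fun j => stretch (v_ j)), (stretch (fun y => a * y)); split.
- by move=> j; split; [exact: (stretch_homeo_into (pv j))|exact: (stretch_W11loc (pv j))].
- exact: stretch_loc_unif_cvg.
- exists set0; split=> // p [_ /=]; apply; exact: stretch_linear_differentiable.
- by move=> Omega Psi oO bO O0 _; exact: limsup_stretch_lt.
Qed.

End limsup_of_stretches.

(** * Linear and zigzag counterexamples *)

Section counterexamples.
Variables (R : realType) (m : nat).
Local Notation V := 'rV[R]_m.+1.
Local Notation leb := (@lebesgue_measure R).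
Local Notation top := (@ord_max m).
Variables (D : set V) (Phi : \bar R -> \bar R).

Definition not_lower_semicontinuous : Prop :=
  exists (fs : nat -> V -> V) (f : V -> V),
    [/\ forall j, homeo_into D (fs j) /\ W11loc D (fs j),
        loc_unif_cvg D fs f,
        ae_differentiable D f &
        forall (Omega : set V) (Psi : V -> R),
          open Omega -> bounded_set Omega -> Omega !=set0 -> Omega `<=` D ->
          continuous Psi -> (forall x, 0 < Psi x) ->
          (limn_esup (fun j => intRn Omega
              (fun x => Phi (Pf (fs j) x) * (Psi x)%:E)%E)
           < intRn Omega (fun x => Phi (Pf f x) * (Psi x)%:E)%E)%E].

Lemma is_derive_scale (a y : R) : is_derive y 1 (fun z => a * z) a.
Proof.
have := is_derive_affine a 0 y.
by rewrite [X in is_derive _ _ X _](_ : _ = fun z => a * z)//; apply/funext => z; rewrite addr0.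
Qed.

Lemma linear_profile (a : R) : 0 < a ->
  profile (fun y => a * y) (cst a) set0 a a.
Proof.
move=> a0; split=> //.
- by move=> y z; rewrite -mulrBr normrM gtr0_norm// lexx.
- by move=> y /=; rewrite gtr0_norm.
- by move=> y _; exact: is_derive_scale.
Qed.

(** The conditions on [Phi] are phrased through the slope of an arbitrary [v], so that expanding,
    contracting and degenerate stretches are treated alike. The density is the constant [L]. *)
Lemma linear_counterexample (a_ : nat -> R) (a L : R) (P : \bar R) :
  (forall j, 0 < a_ j) -> a_ @ \oo --> a -> 0 <= L ->
  (forall j (v : R -> R) (x : V), is_derive (x 0 top) 1 v (a_ j) ->
     (Phi (Pf (stretch v) x) <= L%:E)%E) ->
  (forall (v : R -> R) (x : V), is_derive (x 0 top) 1 v a -> Pf (stretch v) x = P) ->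
  (L%:E < Phi P)%E -> not_lower_semicontinuous.
Proof.
move=> a0 acvg L0 PhiL Pa LP.
apply: (@stretch_counterexample R m D Phi (fun j y => a_ j * y) (fun j => cst (a_ j))
  (fun=> set0) a_ a_ a (fun _ => cst L) L L P) => //.
- by move=> j; exact: linear_profile.
- move=> M eps eps0.
  have M1 : 0 < `|M| + 1 by rewrite ltr_wpDl.
  have /cvgrPdist_lt/(_ (eps / (`|M| + 1))) := acvg.
  rewrite divr_gt0// => /(_ isT); apply: filterS => j aj y yM.
  rewrite -mulrBl normrM distrC.
  apply: (@le_lt_trans _ _ (`|a - a_ j| * (`|M| + 1))).
    by rewrite ler_wpM2l// (le_trans yM)// (le_trans (ler_norm _))// lerDl.
  by rewrite -ltr_pdivlMr.
- by move=> j y /=; rewrite L0 lexx.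
- by move=> j x _ /=; apply: (PhiL j); exact: is_derive_scale.
- move=> h M ih; rewrite [X in X @ _ --> _](_ : _ =
      cst (L * \int[leb]_(y in `[(- M%:R), M%:R[) h y)); first exact: cvg_cst.
  by apply/funext => j; exact: RintegralZl.
- by move=> x; apply: Pa; exact: is_derive_scale.
Qed.

Lemma zigzag_counterexample (l a b A B : R) (P : \bar R) :
  0 < l < 1 -> 0 < a -> 0 < b -> 0 <= A -> 0 <= B ->
  (forall (v : R -> R) (x : V), is_derive (x 0 top) 1 v a ->
     (Phi (Pf (stretch v) x) <= A%:E)%E) ->
  (forall (v : R -> R) (x : V), is_derive (x 0 top) 1 v b ->
     (Phi (Pf (stretch v) x) <= B%:E)%E) ->
  (forall (v : R -> R) (x : V),
     is_derive (x 0 top) 1 v (l * a + (1 - l) * b) -> Pf (stretch v) x = P) ->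
  ((l * A + (1 - l) * B)%:E < Phi P)%E -> not_lower_semicontinuous.
Proof.
move=> l01 a0 b0 A0 B0 PhiA PhiB Pc LP.
have /andP[l0 l1] := l01.
pose d (j : nat) : R := j.+1%:R^-1.
have d0 j : 0 < d j by rewrite invr_gt0.
have L0 : 0 <= l * A + (1 - l) * B.
  by rewrite addr_ge0// mulr_ge0// ?ltW// subr_gt0.
pose rho j y := zigzag' l A B (d j) y.
have rho_in j y : rho j y = if y \in steep l (d j) then A else B.
  rewrite /rho /zigzag' indicE; case: (_ \in _); first by rewrite mulr1 addrC subrK.
  by rewrite mulr0 addr0.
apply: (@stretch_counterexample R m D Phi (fun j => zigzag l a b (d j))
  (fun j => zigzag' l a b (d j)) (fun j => kinks l (d j))
  (fun=> Num.min a b) (fun=> Num.max a b) (l * a + (1 - l) * b) rho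
  (l * A + (1 - l) * B) (Num.max A B) P).
- by move=> j; exact: zigzag_profile.
- move=> M eps eps0.
  have : `|a - b| * d j @[j --> \oo] --> `|a - b| * 0.
    by apply: cvgM; [exact: cvg_cst|exact: cvg_harmonic].
  rewrite mulr0 => /cvgrPdist_lt/(_ _ eps0); apply: filterS => j dj y _.
  apply: le_lt_trans (zigzag_near l01 a b (d0 j) y) _.
  by move: dj; rewrite sub0r normrN ger0_norm// mulr_ge0// ltW.
- move=> j; apply: measurable_funD => //; apply: measurable_funM => //.
  exact: (measurable_indic (steep_measurable l01 (d0 j))).
- by move=> j y; rewrite rho_in; case: ifP => _; rewrite ?A0 ?B0 le_max lexx ?orbT.
- move=> j x nk; rewrite rho_in.
  have := profile_derive (zigzag_profile l01 (d0 j) a0 b0) nk.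
  rewrite /zigzag' indicE; case: (_ \in _) => /=.
    by rewrite mulr1 addrC subrK; exact: PhiA.
  by rewrite mulr0 addr0; exact: PhiB.
- move=> h M ih; set E : set (measurableTypeR R) := `[- M%:R, M%:R[%classic in ih *.
  have mE : measurable E by exact: measurable_itv.
  have iL : leb.-integrable E (EFin \o (fun y => (l * A + (1 - l) * B) * h y)).
    exact: (integrableZl mE _ ih).
  have io j := osc_integrable l01 (d0 j) mE ih.
  have iAo j : leb.-integrable E (EFin \o (fun y => (A - B) * (osc l (d j) y * h y))).
    exact: (integrableZl mE _ (io j)).
  (* The density is its mean [l * A + (1 - l) * B] plus [A - B] times [osc], and the second part
     tends weakly to 0. *)
  rewrite [X in X @ _ --> _](_ : _ = fun j =>
      (l * A + (1 - l) * B) * \int[leb]_(y in E) h y +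
      (A - B) * \int[leb]_(y in E) (osc l (d j) y * h y)); last first.
    apply/funext => j; rewrite -(RintegralZl _ mE ih) -(RintegralZl _ mE (io j)).
    rewrite -(RintegralD mE iL (iAo j)); apply: eq_Rintegral => y _.
    by rewrite /rho /zigzag' /osc; ring.
  rewrite -[X in _ --> X]addr0; apply: cvgD; first exact: cvg_cst.
  rewrite -(mulr0 (A - B)); apply: cvgM; first exact: cvg_cst.
  exact: (steep_weak_cvg l01 ih).
- exact: L0.
- by move=> x; apply: Pc; exact: is_derive_scale.
- exact: LP.
Qed.

End counterexamples.

(** * Case analysis *)

Section case_analysis.
Variables (R : realType) (m : nat).
Hypothesis m_gt0 : (0 < m)%N.
Local Notation V := 'rV[R]_m.+1.
Variables (D : set V) (Phi : \bar R -> \bar R).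
Hypothesis Phi0 : forall t : \bar R, (1 <= t)%E -> (0 <= Phi t)%E.
Hypothesis Phioo : Phi +oo%E = +oo%E.

Lemma real_bound (x : \bar R) (y : \bar R) : (0 <= x)%E -> (x < y)%E ->
  exists2 A : R, 0 <= A & x = A%:E.
Proof.
case: x => [A A0 _|_|//]; first by exists A.
by rewrite ltNge leey.
Qed.

Lemma not_convex_counterexample : ~ Phi_convex Phi -> not_lower_semicontinuous D Phi.
Proof.
move=> nc; apply: contra_notP nc => nls s t l s1 t1 l01.
rewrite leNgt; apply/negP => lt; apply: nls.
have /andP[l0 l1] := l01.
have s0 : 0 < s by exact: lt_le_trans s1.
have t0 : 0 < t by exact: lt_le_trans t1.
have Ps0 : (0 <= Phi s%:E)%E by apply: Phi0; rewrite lee_fin.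
have Pt0 : (0 <= Phi t%:E)%E by apply: Phi0; rewrite lee_fin.
have l1' : 0 < 1 - l by rewrite subr_gt0.
(* An infinite value would make the right-hand side of the convexity inequality [+oo], and then it
   could not be violated. *)
have Ps_fin : (Phi s%:E < +oo)%E.
  rewrite ltey; apply/eqP => e; move: lt; rewrite e gt0_muley ?lte_fin// addye.
    by rewrite ltNge leey.
  by rewrite -ltNye (lt_le_trans _ (mule_ge0 _ Pt0))// ?lee_fin ?ltW// ltNy0.
have Pt_fin : (Phi t%:E < +oo)%E.
  rewrite ltey; apply/eqP => e; move: lt; rewrite e gt0_muley ?lte_fin// addey.
    by rewrite ltNge leey.
  by rewrite -ltNye (lt_le_trans _ (mule_ge0 _ Ps0))// ?lee_fin ?ltW// ltNy0.
have [A A0 PA] := real_bound Ps0 Ps_fin.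
have [B B0 PB] := real_bound Pt0 Pt_fin.
apply: (@zigzag_counterexample R m D Phi l s t A B (l * s + (1 - l) * t)%:E).
- exact: l01.
- exact: s0.
- exact: t0.
- exact: A0.
- exact: B0.
- by move=> v x vx; rewrite (Pf_stretch_expand m_gt0 vx s1) PA.
- by move=> v x vx; rewrite (Pf_stretch_expand m_gt0 vx t1) PB.
- move=> v x vx; apply: (Pf_stretch_expand m_gt0 vx).
  (* The mean slope is again at least 1, so it is its own [P]. *)
  have ? : l <= l * s by rewrite ler_peMr// ltW.
  have ? : 1 - l <= (1 - l) * t by rewrite ler_peMr// ltW.
  lra.
- by rewrite EFinD !EFinM -PA -PB.
Qed.

Lemma not_nondecreasing_counterexample :
  ~ Phi_nondecreasing Phi -> not_lower_semicontinuous D Phi.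
Proof.
move=> nd; apply: contra_notP nd => nls s t s1 st.
rewrite leNgt; apply/negP => lt; apply: nls.
have t1 : (1 <= t)%E by exact: le_trans st.
(* The larger point is finite: [Phi] is [+oo] at infinity, while its value at [t] lies strictly
   below another one. The value at [s] may well be infinite. *)
case: t => [t| |] in st lt t1 *; last 2 first.
- by move: lt; rewrite Phioo ltNge leey.
- by move: t1; rewrite leNgt ltNye.
case: s => [s| |] in s1 st lt *; last 2 first.
- by move: st; rewrite leNgt ltry.
- by move: s1; rewrite leNgt ltNye.
rewrite !lee_fin in s1 st t1.
have {}st : s < t.
  rewrite lt_neqAle st andbT; apply/negP => /eqP e; move: lt.
  by rewrite e ltxx.
have [B B0 PB] := real_bound (Phi0 (t1 : (1 <= t%:E)%E)) lt.
have t0 : 0 < t by exact: lt_le_trans t1.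
have u0 : 0 < t ^- m by rewrite invr_gt0 exprn_gt0.
have u1 : t ^- m < 1.
  by rewrite invf_lt1 ?exprn_gt0// exprn_egt1// ?(le_lt_trans s1)// -lt0n.
have us : t ^- m < s by exact: lt_le_trans u1 s1.
have ut : 0 < t - t ^- m by rewrite subr_gt0 (lt_trans us).
(* The frequency that makes [s] the mean of the slopes [t] and [t ^- m]; it lies strictly between 0
   and 1 because [t ^- m < 1 <= s < t]. *)
pose l := (s - t ^- m) / (t - t ^- m).
have l01 : 0 < l < 1.
  apply/andP; split; first by apply: divr_gt0 => //; rewrite subr_gt0.
  by rewrite /l ltr_pdivrMr// mul1r ltrD2r.
have lE : l * t + (1 - l) * t ^- m = s.
  by rewrite /l; move: (t ^- m) ut => u ut; field; rewrite gt_eqF.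
apply: (@zigzag_counterexample R m D Phi l t (t ^- m) B B s%:E).
- exact: l01.
- exact: t0.
- exact: u0.
- exact: B0.
- exact: B0.
- by move=> v x vx; rewrite (Pf_stretch_expand m_gt0 vx t1) PB.
- by move=> v x vx; rewrite (Pf_stretch_contract m_gt0 vx t1) PB.
- by move=> v x; rewrite lE => vx; exact: (Pf_stretch_expand m_gt0 vx).
- by rewrite -mulrDl addrC subrK mul1r -PB.
Qed.

Lemma bounded_at_infinity_counterexample :
  ~ (Phi x%:E @[x --> +oo%R] --> Phi +oo%E) -> not_lower_semicontinuous D Phi.
Proof.
rewrite Phioo => /cvgeyPge/existsNP[A nA].
have ex (K : R) : exists x, K < x /\ (Phi x%:E < A%:E)%E.
  apply: contra_notP nA => h; exists K; split; first exact: num_real.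
  move=> x Kx; rewrite leNgt; apply/negP => xA; apply: h; by exists x.
have [x_ hx] := choice (fun j : nat => ex j.+1%:R).
have x1 j : 1 <= x_ j.
  by have [h _] := hx j; rewrite (le_trans _ (ltW h))// ler1n.
have x0 j : 0 < x_ j by exact: lt_le_trans (x1 j).
have A0 : 0 <= A.
  have [_ h] := hx 0%N; rewrite -lee_fin; apply: le_trans (ltW h).
  by apply: Phi0; rewrite lee_fin.
apply: (@linear_counterexample R m D Phi (fun j => x_ j ^- m) 0 A +oo%E).
- by move=> j; rewrite invr_gt0 exprn_gt0.
(* From [j + 1 < x_ j <= x_ j ^ m] the slopes are at most [1/(j+1)]. *)
- apply: (@squeeze_cvgr _ _ _ _ (cst 0) harmonic); last exact: cvg_harmonic.
    apply: nearW => j; apply/andP; split; first by rewrite invr_ge0 exprn_ge0// ltW.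
    rewrite /harmonic /= lef_pV2 ?posrE ?exprn_gt0//.
    have [h _] := hx j; apply: (le_trans (ltW h)).
    by rewrite ler_eXnr.
  exact: cvg_cst.
- exact: A0.
- move=> j v x vx; rewrite (Pf_stretch_contract m_gt0 vx (x1 j)).
  by have [_ /ltW] := hx j.
- by move=> v x vx; exact: (Pf_stretch_degenerate m_gt0 vx).
- by rewrite Phioo ltry.
Qed.

(** If no such [L] existed, every level below [Phi r] would be exceeded somewhere to the left of
    [r], hence by monotonicity on a whole left neighbourhood, and [Phi] would converge to [Phi r],
    finite or not. *)
Lemma left_jump_bound (r : R) : 1 < r -> Phi_nondecreasing Phi ->
  ~ (Phi x%:E @[x --> r^'-] --> Phi r%:E) ->
  exists2 L : R, (L%:E < Phi r%:E)%E &
    forall x, 1 <= x < r -> (Phi x%:E <= L%:E)%E.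
Proof.
move=> r1 nd; apply: contra_notP => nL.
have below (L : R) : (L%:E < Phi r%:E)%E -> \forall x \near r^'-, (L%:E < Phi x%:E)%E.
  move=> Lr; have [x [/andP[x1 xr] Lx]] : exists x, 1 <= x < r /\ (L%:E < Phi x%:E)%E.
    apply: contra_notP nL => h; exists L => // x x1r.
    by rewrite leNgt; apply/negP => ?; apply: h; exists x.
  near=> y; apply: (lt_le_trans Lx); apply: nd; rewrite lee_fin//.
  by near: y; exact: nbhs_left_ge.
have above : \forall x \near r^'-, (Phi x%:E <= Phi r%:E)%E.
  near=> y; apply: nd; rewrite lee_fin.
    by near: y; exact: nbhs_left_ge.
  by near: y; exact: nbhs_left_le.
have : (0 <= Phi r%:E)%E by apply: Phi0; rewrite lee_fin ltW.
case Pr : (Phi r%:E) => [b| |] // b0; last first.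
  by apply/cvgeyPge => A; near=> x; apply: ltW; near: x; apply: below; rewrite Pr ltry.
apply: cvg_EFin.
  near=> x; have xb : (Phi x%:E <= b%:E)%E by rewrite -Pr; near: x.
  rewrite ge0_fin_numE; first exact: le_lt_trans xb (ltry _).
  by apply: Phi0; rewrite lee_fin; near: x; exact: nbhs_left_ge.
apply/cvgrPdist_lt => e e0; near=> x.
have xb : (Phi x%:E <= b%:E)%E by rewrite -Pr; near: x.
have xe : ((b - e)%:E < Phi x%:E)%E.
  by near: x; apply: below; rewrite Pr lte_fin ltrBlDr ltrDl.
move: xb xe => /=; case: (Phi x%:E) => [c| |] //=; rewrite lee_fin lte_fin => h1 h2.
by rewrite ger0_norm ?subr_ge0// ltrBlDr addrC -ltrBlDr.
Unshelve. all: by end_near.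
Qed.

Lemma left_jump_counterexample (r : R) : 1 < r -> Phi_nondecreasing Phi ->
  ~ (Phi x%:E @[x --> r^'-] --> Phi r%:E) -> not_lower_semicontinuous D Phi.
Proof.
move=> r1 nd /(left_jump_bound r1 nd)[L Lr PhiL].
(* Slopes that start at 1 and increase to [r] without reaching it, so that [P] equals the slope all
   along. *)
pose a_ (j : nat) : R := r - (r - 1) / j.+1%:R.
have r10 : 0 < r - 1 by rewrite subr_gt0.
have a1 j : 1 <= a_ j < r.
  rewrite /a_ lerBrDr -lerBrDl ltrBlDr ltrDl divr_gt0// andbT.
  by rewrite ler_pdivrMr// ler_peMr ?ler1n// ltW.
have L0 : 0 <= L.
  rewrite -lee_fin; apply: le_trans (PhiL 1 _); last by rewrite lexx.
  exact: Phi0.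
apply: (@linear_counterexample R m D Phi a_ r L r%:E).
- by move=> j; have /andP[h _] := a1 j; exact: lt_le_trans h.
- rewrite -[X in _ --> X]subr0 -[X in _ - X](mulr0 (r - 1)).
  apply: cvgB; first exact: cvg_cst.
  by apply: cvgM; [exact: cvg_cst|exact: cvg_harmonic].
- exact: L0.
- move=> j v x vx; have /andP[h _] := a1 j.
  by rewrite (Pf_stretch_expand m_gt0 vx h); exact: PhiL.
- by move=> v x vx; exact: (Pf_stretch_expand m_gt0 vx (ltW r1)).
- exact: Lr.
Qed.

Lemma not_leftcont_counterexample : Phi_nondecreasing Phi ->
  ~ Phi_leftcont_T Phi -> not_lower_semicontinuous D Phi.
Proof.
move=> nd; rewrite /Phi_leftcont_T; case Tr : (Phi_T Phi) => [r| |] nl; last 2 first.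
- exact: bounded_at_infinity_counterexample.
- by case: nl.
have /not_orP[r1 nr] := nl.
apply: (left_jump_counterexample _ nd nr).
rewrite lt_neqAle eq_sym; apply/andP; split; first exact/eqP.
(* A finite supremum cannot be below 1: the set it is taken over lies in [[1, +oo[], so it would be
   empty, with supremum [-oo]. *)
rewrite leNgt; apply/negP => r1'.
have : (Phi_T Phi <= -oo)%E.
  apply: ge_ereal_sup => _ [t [t1 tfin] <-]; exfalso.
  have : (t%:E <= Phi_T Phi)%E by apply: ereal_sup_ubound; exists t.
  by rewrite Tr lee_fin leNgt (lt_le_trans r1').
by rewrite Tr leeNy_eq.
Qed.

End case_analysis.

Unset Implicit Arguments.

Theorem theorem8p1 (R : realType) (n : nat) (D : set 'rV[R]_n)
    (Phi : \bar R -> \bar R) :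
  (2 <= n)%N ->
  open D -> connected D -> D !=set0 ->
  (forall t : \bar R, (1 <= t)%E -> (0 <= Phi t)%E) ->
  (exists s t : \bar R, [/\ (1 <= s)%E, (1 <= t)%E & Phi s != Phi t]) ->
  Phi +oo%E = +oo%E ->
  (~ Phi_convex Phi \/ ~ Phi_nondecreasing Phi \/ ~ Phi_leftcont_T Phi) ->
  exists (fs : nat -> 'rV[R]_n -> 'rV[R]_n) (f : 'rV[R]_n -> 'rV[R]_n),
    [/\ forall j, homeo_into D (fs j) /\ W11loc D (fs j),
        loc_unif_cvg D fs f,
        ae_differentiable D f &
        forall (Omega : set 'rV[R]_n) (Psi : 'rV[R]_n -> R),
          open Omega -> bounded_set Omega -> Omega !=set0 -> Omega `<=` D ->
          continuous Psi -> (forall x, 0 < Psi x) ->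
          (limn_esup (fun j => intRn Omega
              (fun x => Phi (Pf (fs j) x) * (Psi x)%:E)%E)
           < intRn Omega (fun x => Phi (Pf f x) * (Psi x)%:E)%E)%E].
Proof.
case: n D => [//|m] D; rewrite ltnS => m0 _ _ _ Phi0 _ Phioo cases.
(* Monotonicity is settled before the other cases because a left discontinuity at a finite point is
   exploited through it. *)
have [nd|nnd] := pselect (Phi_nondecreasing Phi); last first.
  exact: not_nondecreasing_counterexample.
case: cases => [nc|[//|nl]]; first exact: not_convex_counterexample.
exact: not_leftcont_counterexample.
Qed.
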